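(* Consider the Markovian Hawkes-fed infinite-server queue with parameters $\lambda_\infty,r,\mu>0$ and mark $B$, with $\Lambda(0)=\lambda_\infty$, $N(0)=0$. Let $b_1:=\mathbb{E}B<\infty$, suppose $r\ne b_1$, and put $r_0:=r-b_1$. Then for all $t\ge0$, $$\mathbb{E}\Lambda(t)=\frac{\lambda_\infty r}{r_0}-\frac{\lambda_\infty b_1}{r_0}e^{-r_0t},$$ $$\mathbb{E}N(t)=\frac{\lambda_\infty r}{\mu r_0}-\frac{\lambda_\infty b_1}{r_0(\mu-r_0)}e^{-r_0t}+\frac{\lambda_\infty(r-\mu)}{\mu(\mu-r_0)}e^{-\mu t},$$ where, when $\mu=r_0$, the right-hand side of the second formula is understood as its limit as $\mu\to r_0$.
   Context: Markovian Hawkes-fed infinite-server queue: fix $\lambda_\infty>0$, $r>0$, $\mu>0$ and a random variable $B$ with $\mathbb{P}(B>0)=1$; let $B_1,B_2,\dots$ be i.i.d. copies of $B$. The arrival process $(M(t))_{t\ge0}$ is a Hawkes process: a counting process with arrival epochs $t_1<t_2<\cdots$ and associated filtration $\mathscr{F}(t)$ such that, as $\Delta t\downarrow 0$, $\mathbb{P}(M(t+\Delta t)-M(t)=1\mid\mathscr{F}(t))=\Lambda(t)\Delta t+o(\Delta t)$, the conditional probability of more than one arrival is $o(\Delta t)$, and that of no arrival is $1-\Lambda(t)\Delta t+o(\Delta t)$, where $\Lambda(t)=\lambda_\infty+\sum_{t_i<t}B_i e^{-r(t-t_i)}$; in particular $\Lambda(0)=\lambda_\infty$. Each arrival is a customer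 taken into service immediately; service requirements are i.i.d. exponential with rate $\mu$, independent of everything else. $N(t)$ is the number of customers in the system at time $t$, with $N(0)=0$. *)

(* Defs.v *)
From HB Require Import structures.
From mathcomp Require Import all_boot all_order all_algebra finmap.
From mathcomp Require Import all_classical all_reals all_analysis.

Set Implicit Arguments.
Unset Strict Implicit.
Unset Printing Implicit Defensive.

Import Order.TTheory GRing.Theory Num.Theory.
Import numFieldNormedType.Exports.

Local Open Scope classical_set_scope.
Local Open Scope ring_scope.

Section Independence.
Context {d : measure_display} {T : measurableType d} {R : realType}.
Variable P : probability T R.

Definition sigma_family (D : set nat) (X : nat -> T -> R) : set (set T) :=
  <<s \bigcup_(i in D) preimage_set_system setT (X i) measurable >>.

Definition sigma_join (F G : set (set T)) : set (set T) := <<s F `|` G >>.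

Definition independent_sigma (F G : set (set T)) : Prop :=
  forall A B : set T, F A -> G B -> P (A `&` B) = (P A * P B)%E.

(* Every finite subfamily is covered, since [A i] may be [setT]. *)
Definition mutually_independent (X : nat -> T -> R) : Prop :=
  forall (n : nat) (A : nat -> set R), (forall i, measurable (A i)) ->
    P (\bigcap_(i in `I_n) (X i @^-1` A i)) =
    (\prod_(i < n) P (X i @^-1` A i))%E.

(* [c] is a version of the conditional probability of [E] given the
   sub-sigma-algebra [F]. *)
Definition is_cond_prob (F : set (set T)) (E : set T) (c : T -> R) : Prop :=
  [/\ forall V : set R, measurable V -> F (c @^-1` V),
      P.-integrable setT (EFin \o c)
    & forall A, F A -> (\int[P]_(w in A) (c w)%:E)%E = P (A `&` E)].

(* P(E dt | F) = g dt + o(dt) as dt decreases to 0.  The remainder is random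
   and the o(dt) is taken in L^1(P).  The expectation is an extended real, so
   an infinite L^1 distance is not mistaken for a null one. *)
Definition cond_prob_expansion (F : set (set T)) (E : R -> set T)
    (g : R -> T -> R) : Prop :=
  exists c : R -> T -> R,
    (forall dt : R, 0 < dt -> is_cond_prob F (E dt) (c dt)) /\
    ((dt^-1)%:E * 'E_P[fun w => `|c dt w - g dt w|%R])%E @[dt --> 0^'+] --> 0%E.

End Independence.

Section HawkesQueue.
Context {d : measure_display} {T : measurableType d} {R : realType}.

(* Indices start at 0: [tau i], [B i], [S i] are the arrival epoch, the mark and
   the service requirement of the (i+1)-st customer.  The cardinals and the sum
   below are over finite sets as soon as [tau] tends to infinity; over infinite
   sets they would take default values. *)

Definition arrivals (tau : nat -> T -> R) (t : R) (w : T) : nat :=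
  #|` fset_set [set i | tau i w <= t] |.

Definition intensity (lam r : R) (tau B : nat -> T -> R) (t : R) (w : T) : R :=
  lam + \sum_(i \in [set i | tau i w < t]) B i w * expR (- r * (t - tau i w)).

Definition in_system (tau S : nat -> T -> R) (t : R) (w : T) : nat :=
  #|` fset_set [set i | tau i w <= t < tau i w + S i w] |.

(* Internal history up to time [t] of the marked point process: it records the
   epochs up to [t] together with their marks. *)
Definition history (tau B : nat -> T -> R) (t : R) : set (set T) :=
  <<s [set E | exists i s (V : set R), [/\ s <= t, measurable V &
         E = [set w | tau i w <= s /\ V (B i w)]] ] >>.

Record is_hawkes (P : probability T R)
    (d0 : measure_display) (T0 : measurableType d0) (P0 : probability T0 R)
    (B0 : {RV P0 >-> R}) (lam r : R) (tau B : nat -> {RV P >-> R}) : Prop := {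
  epoch_gt0 : forall w, 0 < tau 0%N w ;
  epoch_increasing : forall n w, tau n w < tau n.+1 w ;
  (* a counting process takes finite values *)
  epoch_nonexplosive : forall w, tau n w @[n --> \oo] --> +oo ;
  mark_distribution : forall n (V : set R), measurable V ->
    distribution P (B n) V = distribution P0 B0 V ;
  mark_independent : mutually_independent P B ;
  (* the mark of an arrival is independent of the earlier marks and of the
     epochs up to and including its own *)
  mark_unpredictable : forall n, independent_sigma P
    (sigma_join (sigma_family `I_n.+1 tau) (sigma_family `I_n B))
    (sigma_family [set n] B) ;
  hawkes_one : forall t : R, 0 <= t ->
    cond_prob_expansion P (history tau B t)
      (fun dt => [set w | (arrivals tau (t + dt) w - arrivals tau t w = 1)%N])
      (fun dt w => intensity lam r tau B t w * dt) ;
  hawkes_many : forall t : R, 0 <= t ->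
    cond_prob_expansion P (history tau B t)
      (fun dt => [set w | (1 < arrivals tau (t + dt) w - arrivals tau t w)%N])
      (fun dt w => 0) ;
  hawkes_none : forall t : R, 0 <= t ->
    cond_prob_expansion P (history tau B t)
      (fun dt => [set w | (arrivals tau (t + dt) w - arrivals tau t w = 0)%N])
      (fun dt w => 1 - intensity lam r tau B t w * dt)
}.

Record is_service (P : probability T R) (mu : R)
    (tau B S : nat -> {RV P >-> R}) : Prop := {
  service_distribution : forall n (V : set R), measurable V ->
    distribution P (S n) V = exponential_prob mu V ;
  service_independent : mutually_independent P S ;
  service_independent_arrivals : independent_sigma P
    (sigma_join (sigma_family setT tau) (sigma_family setT B))
    (sigma_family setT S)
}.

End HawkesQueue.

Definition mean_intensity {R : realType} (lam r b1 t : R) : R :=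
  let r0 := r - b1 in
  lam * r / r0 - lam * b1 / r0 * expR (- r0 * t).

Definition mean_in_system {R : realType} (lam r b1 mu t : R) : R :=
  let r0 := r - b1 in
  lam * r / (mu * r0)
  - lam * b1 / (r0 * (mu - r0)) * expR (- r0 * t)
  + lam * (r - mu) / (mu * (mu - r0)) * expR (- mu * t).

(* Main.v *)
Require Import Defs.
From HB Require Import structures.
From mathcomp Require Import all_boot all_order all_algebra finmap.
From mathcomp Require Import all_classical all_reals all_analysis.
From mathcomp Require Import measurable_realfun ring lra.
Import Order.TTheory GRing.Theory Num.Theory.
Import numFieldNormedType.Exports.
Local Open Scope classical_set_scope.
Local Open Scope ring_scope.

(** Only right derivatives are used, never an integral over time.  For [a >= 0]
    put [Z_N(t) = \sum_(n <= N) E[exp(a tau_n); tau_n <= t]].  Its increment over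
    [t, t + h] is squeezed between multiples of the probabilities of one and of
    several arrivals, so its right derivative is
    [exp(a t) E[Lambda(t); t < tau_N]].  As [Lambda(t)] ignores an arrival at
    time [t] itself, an atom of [tau_k] at [s] would make these derivatives jump
    up just after [s], which is incompatible with the right derivative at [s]:
    the epochs have no atoms.  Hence the [Z_N], and their limit [Z_a], are
    continuous, and [Z_a] has right derivative [exp(a t) E Lambda(t)].  Since marks
    are independent of their epochs,
    [E Lambda(t) = lam + b1 exp(- r t) Z_r(t)], a linear equation for [Z_r]; and
    as services are exponential, [E N(t) = exp(- mu t) Z_mu(t)]. *)

(** * Right derivatives *)

(** [is_hawkes] gives, at each fixed time, an expansion in L^1(P) as the step decreases to 0, with
    no uniformity in time. This supports differentiation from the right only, and a right derivative
    leaves left jumps free: excluding atoms is what controls the left side.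

    The sums stop at a fixed [N] because the expansions control the probability of several arrivals,
    not their expected number. With at most [N + 1] epochs counted, several arrivals contribute at
    most [N + 1] times an [o(h)]. Finiteness as [N] grows has another source: the L^1 distance is
    eventually finite, which makes [Lambda(t)] integrable, and since [b1 > 0] this bounds [Z_r(t)];
    each [Z_a(t)] is in turn at most a multiple of [Z_r(t)].

    The weight [exp(a tau)] separates time from epoch in both kernels, [exp(- r (t - tau))] for the
    intensity and [exp(- mu (t - tau))] for a service still running, so one family of functions
    serves both means. *)

Section RightDerivative.
Set Implicit Arguments.
Unset Strict Implicit.
Context {R : realType}.
Implicit Types (G u v : R -> R) (a b t l K : R).

Definition rderiv G t l : Prop :=
  h^-1 * (G (t + h) - G t) @[h --> 0^'+] --> l.

(* The set of points up to which the bound holds with slope [K - e] is closed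
   from the left and extends to the right of each of its points. *)
Lemma rderiv_ge G (g : R -> R) a b K : a <= b ->
  (forall c, a < c <= b -> forall e, 0 < e -> \forall x \near c^'-, G x <= G c + e) ->
  (forall x, a <= x < b -> rderiv G x (g x) /\ K <= g x) ->
  K * (b - a) <= G b - G a.
Proof.
rewrite le_eqVlt => /predU1P[->|ab] Gl Gr; first by rewrite !subrr mulr0.
suff H e : 0 < e -> (K - e) * (b - a) <= G b - G a.
  apply/ler_addgt0Pr => e e0.
  have ba : 0 < b - a by rewrite subr_gt0.
  have := H (e / (b - a)) (divr_gt0 e0 ba).
  by rewrite mulrBl divfK ?gt_eqF// lerBlDr.
move=> e0.
pose S := [set x | a <= x <= b /\ (K - e) * (x - a) <= G x - G a].
have Sa : S a by split; rewrite ?lexx ?(ltW ab)// !subrr mulr0.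
have supS : has_sup S.
  by split; [exists a | exists b => x [/andP[]]].
set c := sup S.
have ac : a <= c by apply: ub_le_sup => //; case: supS.
have cb : c <= b by apply: ge_sup => [|x [/andP[]]//]; exists a.
have Sc : S c.
  split; first by rewrite ac cb.
  have [<-|a_neq_c] := eqVneq a c; first by rewrite !subrr mulr0.
  have {a_neq_c}ac' : a < c by rewrite lt_neqAle a_neq_c.
  apply/ler_addgt0Pr => e' e'0.
  have e'2 : 0 < e' / 2 by rewrite divr_gt0.
  have acb : a < c <= b by rewrite ac' cb.
  have [d /= d0 Hd] := Gl c acb _ e'2.
  (* Within [d'] of [c] the linear term moves by at most [e' / 2]; the [+ 1] keeps the divisor
     positive. *)
  pose d' := Num.min d (e' / 2 / (`|K - e| + 1)).
  have n0 : 0 < `|K - e| + 1 by rewrite ltr_pwDr.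
  have d'0 : 0 < d' by rewrite lt_min d0 divr_gt0.
  have [x Sx cx] := sup_adherent d'0 supS.
  have xc : x <= c by apply: ub_le_sup => //; case: supS.
  have [xcE|x_neq_c] := eqVneq x c.
    by move: Sx.2; rewrite xcE => /le_trans; apply; rewrite lerDl ltW.
  have x_lt_c : x < c by rewrite lt_neqAle x_neq_c.
  have cxd : c - x < d' by move: cx; rewrite -/c; lra.
  have Gxc : G x <= G c + e' / 2.
    apply: Hd => //=; rewrite gtr0_norm ?subr_gt0//.
    by apply: lt_le_trans cxd _; rewrite ge_min lexx.
  have : `|(K - e) * (c - x)| <= e' / 2.
    rewrite normrM (gtr0_norm (_ : 0 < c - x)) ?subr_gt0//.
    apply: (@le_trans _ _ ((`|K - e| + 1) * d')).
      apply: ler_pM => //; [by rewrite subr_ge0 |by rewrite lerDl| exact: ltW].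
    by rewrite mulrC -ler_pdivlMr// ge_min lexx orbT.
  have := Sx.2; move: Gxc.
  rewrite ler_norml => ? ? /andP[? ?]; lra.
have [<-|c_neq_b] := eqVneq c b; first exact: Sc.2.
have {c_neq_b}c_lt_b : c < b by rewrite lt_neqAle c_neq_b.
have acb : a <= c < b by rewrite ac c_lt_b.
have [/cvgrPdist_lt/(_ _ e0) [d /= d0 Hd] Kg] := Gr c acb.
(* [d / 2] keeps [h] strictly below [d], and [b - c] keeps [c + h] within [[a, b]]. *)
pose h := Num.min (d / 2) (b - c).
have h0 : 0 < h by rewrite lt_min divr_gt0// subr_gt0.
have : S (c + h).
  split.
    apply/andP; split; first by rewrite (le_trans ac)// lerDl ltW.
    by rewrite addrC -lerBrDr ge_min lexx orbT.
  have : `|g c - h^-1 * (G (c + h) - G c)| < e.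
    apply: Hd => //=; rewrite sub0r normrN gtr0_norm//.
    by rewrite (@le_lt_trans _ _ (d / 2)) ?ge_min ?lexx//; lra.
  rewrite ltr_norml => /andP[_ ghe].
  have : (K - e) * h <= G (c + h) - G c.
    by rewrite -ler_pdivlMr// mulrC; lra.
  by have := Sc.2; lra.
move=> /ub_le_sup => /(_ (proj2 supS)); rewrite -/c; lra.
Qed.

Lemma rderivD u v t l l' :
  rderiv u t l -> rderiv v t l' -> rderiv (fun x => u x + v x) t (l + l').
Proof.
move=> ul vl; rewrite /rderiv.
under eq_fun do rewrite opprD addrACA mulrDr.
exact: cvgD.
Qed.

Lemma rderivN u t l : rderiv u t l -> rderiv (fun x => - u x) t (- l).
Proof.
move=> ul; rewrite /rderiv.
under eq_fun do rewrite -opprD mulrN.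
exact: cvgN.
Qed.

Lemma rderiv_right_cvg u t l : rderiv u t l -> u (t + h) @[h --> 0^'+] --> u t.
Proof.
move=> ul.
have h0 : h @[h --> (0:R)^'+] --> (0:R) by apply: cvg_at_right_filter; exact: cvg_id.
have : h * (h^-1 * (u (t + h) - u t)) + u t @[h --> 0^'+] --> 0 * l + u t.
  by apply: cvgD; [exact: cvgM|exact: cvg_cst].
rewrite mul0r add0r; apply: cvg_trans; apply: near_eq_cvg.
by near=> h; rewrite /= mulrA divff ?mul1r ?subrK.
Unshelve. all: by end_near. Qed.

Lemma rderivM u v t l l' : rderiv u t l -> rderiv v t l' ->
  rderiv (fun x => u x * v x) t (l * v t + u t * l').
Proof.
move=> ul vl; rewrite /rderiv.
have -> : (fun h => h^-1 * (u (t + h) * v (t + h) - u t * v t)) =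
    (fun h => h^-1 * (u (t + h) - u t) * v t + u (t + h) * (h^-1 * (v (t + h) - v t))).
  by apply/funext => h; ring.
apply: cvgD; first by apply: cvgM => //; exact: cvg_cst.
by apply: cvgM => //; exact: rderiv_right_cvg ul.
Qed.

Lemma derive_rderiv u t l : is_derive t 1 u l -> rderiv u t l.
Proof.
move=> ul.
have [+ ue] := ul.
move=> /cvg_ex[l' Hl'].
have : l' = l by rewrite -ue; apply/esym; exact: cvg_lim.
move=> <-; apply: cvg_dnbhs_at_right.
move: Hl'; apply: cvg_trans; apply: near_eq_cvg.
by near=> h; rewrite /= [h *: 1]mulr1 [t + h]addrC.
Unshelve. all: by end_near. Qed.

Lemma is_derive_expRM a t : is_derive t 1 (fun x => expR (a * x)) (a * expR (a * t)).
Proof.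
by apply: is_derive_eq; rewrite /GRing.scale/= mulr1 mulrC.
Qed.

Lemma rderiv_expR a t : rderiv (fun x => expR (a * x)) t (a * expR (a * t)).
Proof. exact/derive_rderiv/is_derive_expRM. Qed.

Lemma expR_left_cvg a t : expR (a * x) @[x --> t^'-] --> expR (a * t).
Proof.
apply: cvg_at_left_filter; apply: continuous_cvg; first exact: continuous_expR.
by apply: cvgM; [exact: cvg_cst|exact: cvg_id].
Qed.

Lemma rderiv_cst a t : rderiv (fun=> a) t 0.
Proof. exact/derive_rderiv. Qed.

Lemma rderivZ a u t l : rderiv u t l -> rderiv (fun x => a * u x) t (a * l).
Proof.
move=> ul; have := rderivM (@rderiv_cst a t) ul.
by rewrite mul0r add0r.
Qed.

Lemma rderiv_id t : rderiv id t 1.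
Proof. exact/derive_rderiv. Qed.

(** [rderiv_ge] with slope 0, for [u] and for [- u]. Its left condition is one-sided, and using both
    signs is what demands genuine left continuity. *)
Lemma rderiv0_cst u t : 0 <= t ->
  (forall c, 0 < c <= t -> u x @[x --> c^'-] --> u c) ->
  (forall x, 0 <= x < t -> rderiv u x 0) -> u t = u 0.
Proof.
move=> t0 ul ur.
have H1 : 0 * (t - 0) <= u t - u 0.
  apply: (@rderiv_ge _ (fun=> 0)) => // [c ct e e0|x xt]; last by split; [exact: ur|].
  have /cvgrPdist_le/(_ _ e0) := ul c ct.
  by apply: filterS => x; rewrite ler_norml => /andP[]; lra.
have H2 : 0 * (t - 0) <= - u t - - u 0.
  apply: (@rderiv_ge (fun x => - u x) (fun=> 0)) => // [c ct e e0|x xt].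
    have /cvgrPdist_le/(_ _ e0) := ul c ct.
    by apply: filterS => x; rewrite ler_norml => /andP[]; lra.
  by split => //; rewrite -oppr0; apply/rderivN/ur.
by apply/eqP; rewrite eq_le; apply/andP; split; lra.
Qed.

End RightDerivative.

(** * Independence *)

Section Independence.
Set Implicit Arguments.
Unset Strict Implicit.
Local Open Scope ereal_scope.
Context {d : measure_display} {T : measurableType d} {R : realType}.
Variable P : probability T R.

Lemma sigma_family_preimage (D : set nat) (X : nat -> T -> R) i (V : set R) :
  D i -> measurable V -> sigma_family D X (X i @^-1` V).
Proof.
move=> Di mV; apply: sub_gen_smallest; exists i => //.
by exists V => //; rewrite setTI.
Qed.

Lemma sigma_joinl (F G : set (set T)) A : F A -> sigma_join F G A.
Proof. by move=> FA; apply: sub_gen_smallest; left. Qed.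

(** Equality on rectangles identifies the law of the pair with the product of the two laws, by
    uniqueness of the product measure; Tonelli then splits the integral. *)
Lemma independent_integral d1 d2 (T1 : measurableType d1) (T2 : measurableType d2)
    (X : {RV P >-> T1}) (Y : {RV P >-> T2}) (f : T1 * T2 -> \bar R) :
  (forall U V, measurable U -> measurable V ->
    P (X @^-1` U `&` Y @^-1` V) = P (X @^-1` U) * P (Y @^-1` V)) ->
  measurable_fun setT f -> (forall z, 0 <= f z) ->
  \int[P]_w f (X w, Y w) =
  \int[distribution P X]_x \int[distribution P Y]_y f (x, y).
Proof.
move=> XY mf f0.
have mXY : measurable_fun setT (fun w => (X w, Y w)).
  exact: measurable_fun_pair.
pose Z : {mfun T >-> (T1 * T2)%type} := HB.pack (fun w => (X w, Y w))
  (isMeasurableFun.Build _ _ _ _ _ mXY).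
rewrite -(@fubini_tonelli1 _ _ _ _ _ (distribution P X) (distribution P Y))//.
rewrite -[LHS](@ge0_integral_distribution _ _ _ _ _ P Z)//.
apply: eq_measure_integral => A mA _.
by apply/esym/(@product_measure_unique _ _ _ _ _ (distribution P X)
  (distribution P Y) (distribution P Z)).
Qed.

Lemma independent_integralM d1 d2 (T1 : measurableType d1) (T2 : measurableType d2)
    (X : {RV P >-> T1}) (Y : {RV P >-> T2}) (g : T1 -> \bar R) (h : T2 -> \bar R) :
  (forall U V, measurable U -> measurable V ->
    P (X @^-1` U `&` Y @^-1` V) = P (X @^-1` U) * P (Y @^-1` V)) ->
  measurable_fun setT g -> measurable_fun setT h ->
  (forall x, 0 <= g x) -> (forall x, 0 <= h x) ->
  \int[P]_w (g (X w) * h (Y w)) = \int[P]_w g (X w) * \int[P]_w h (Y w).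
Proof.
move=> XY mg mh g0 h0.
rewrite (@independent_integral _ _ _ _ X Y (fun z => g z.1 * h z.2))//; last first.
- by move=> z; rewrite mule_ge0.
- by apply: emeasurable_funM; exact: measurableT_comp.
under eq_integral do rewrite /= ge0_integralZl//.
by rewrite ge0_integralZr//= ?integral_ge0// !ge0_integral_distribution.
Qed.

Lemma exponential_ccdf (mu : R) (X : {RV P >-> R}) (x : R) :
  (forall V, measurable V -> distribution P X V = exponential_prob mu V) ->
  (0 <= x)%R -> P (X @^-1` `]x, +oo[) = (expR (- mu * x))%:E.
Proof.
move=> XE x0.
have neg : P (X @^-1` `]-oo, 0%R[) = 0.
  rewrite -[LHS]/(distribution P X _) XE//.
  rewrite /exponential_prob integral0_eq// => z.
  by rewrite /= in_itv/= => z0; rewrite lt0_exponential_pdf.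
have c0x : P (X @^-1` `[0%R, x]) = (1 - expR (- mu * x))%:E.
  rewrite -[LHS]/(distribution P X _) XE//.
  (* The formula on [[0, x]] is used for [0 < x]; at 0 the interval is a single point, of measure
     zero. *)
  move: x0; rewrite le_eqVlt => /predU1P[<-|x0].
    by rewrite set_itv1 /exponential_prob integral_set1 mulr0 expR0 subrr.
  by rewrite exponential_prob_itv0c// EFinB.
have -> : X @^-1` `]x, +oo[ = ~` (X @^-1` `]-oo, 0%R[ `|` X @^-1` `[0%R, x]).
  rewrite -preimage_setU preimage_setC; congr (_ @^-1` _).
  apply/seteqP; split => z /=; rewrite !in_itv/= ?andbT.
    by move=> xz [|/andP[]]; lra.
  move=> H; rewrite ltNge; apply/negP => zx; apply: H.
  by case: (ltP z 0%R) => z0; [left|right].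
rewrite probability_setC; last first.
  by apply: measurableU; rewrite -[X in measurable X]setTI; exact: measurable_funPT.
rewrite measureU//; last 3 first.
- by rewrite -[X in measurable X]setTI; exact: measurable_funPT.
- by rewrite -[X in measurable X]setTI; exact: measurable_funPT.
- rewrite -preimage_setI -(preimage_set0 X); congr (_ @^-1` _).
  by apply/seteqP; split => z //=; rewrite !in_itv/= => -[] z0 /andP[]; lra.
by rewrite [X in 1 - (X + _)]neg [X in 1 - (_ + X)]c0x add0e -EFinB opprB addrC subrK.
Qed.

End Independence.

(** * Paths of the arrival process *)

Section Paths.
Set Implicit Arguments.
Unset Strict Implicit.
Context {R : realType}.

(** [exp_le] includes an epoch at [t], as [arrivals] does; [exp_lt] excludes it, as [intensity]
    does. *)
Definition exp_le (a t u : R) : R := if u <= t then expR (a * u) else 0.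
Definition exp_lt (a t u : R) : R := if u < t then expR (a * u) else 0.

Lemma exp_le_ge0 a t u : 0 <= exp_le a t u.
Proof. by rewrite /exp_le; case: ifP => // _; exact: expR_ge0. Qed.

Lemma exp_lt_ge0 a t u : 0 <= exp_lt a t u.
Proof. by rewrite /exp_lt; case: ifP => // _; exact: expR_ge0. Qed.

Lemma measurable_exp_le a t : measurable_fun setT (exp_le a t).
Proof.
apply: measurable_fun_if => //; first exact: measurable_fun_ler.
apply: measurable_funTS; apply: measurableT_comp => //.
Qed.

Lemma measurable_exp_lt a t : measurable_fun setT (exp_lt a t).
Proof.
apply: measurable_fun_if => //; first exact: measurable_fun_ltr.
apply: measurable_funTS; apply: measurableT_comp => //.
Qed.

Lemma eseries_finite_support (u : nat -> R) N :
  (forall n, (N <= n)%N -> u n = 0) ->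
  (\sum_(n <oo) (u n)%:E)%E = (\sum_(i < N) u i)%:E.
Proof.
move=> uN; apply: lim_near_cst => //; near=> n.
have Nn : (N <= n)%N by near: n; exists N.
rewrite (big_cat_nat (leq0n N) Nn)/= [X in (_ + X)%E](_ : _ = 0%E).
  by rewrite adde0 sumEFin big_mkord.
by rewrite big_nat_cond big1// => i /andP[/andP[Ni _] _]; rewrite uN.
Unshelve. all: by end_near. Qed.

Variable x : nat -> R.
Hypothesis x_incr : forall n, x n < x n.+1.
Hypothesis x_oo : x n @[n --> \oo] --> +oo.

Lemma epoch_le n m : (n <= m)%N -> x n <= x m.
Proof.
by elim: m n => [|m IH] n; rewrite leq_eqVlt => /predU1P[-> //|//] /IH /le_trans;
  apply; exact: ltW.
Qed.

Lemma epoch_count t : exists N, forall n, (n < N)%N = (x n <= t).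
Proof.
have exN : exists n, t < x n.
  have /cvgryPgt/(_ t) [N _ HN] := x_oo.
  by exists N; apply: HN => /=.
exists (ex_minn exN) => n; case: ex_minnP => N tN Nmin.
apply/idP/idP => [nN|nt].
  by rewrite leNgt; apply/negP => /Nmin; rewrite leqNgt nN.
by rewrite ltnNge; apply/negP => /epoch_le Nn; move: (lt_le_trans tN Nn); rewrite ltNge nt.
Qed.

Lemma epoch_count_lt t : exists N, forall n, (n < N)%N = (x n < t).
Proof.
have exN : exists n, t <= x n.
  have /cvgryPge/(_ t) [N _ HN] := x_oo.
  by exists N; apply: HN => /=.
exists (ex_minn exN) => n; case: ex_minnP => N tN Nmin.
apply/idP/idP => [nN|nt].
  by rewrite ltNge; apply/negP => /Nmin; rewrite leqNgt nN.
by rewrite ltnNge; apply/negP => /epoch_le Nn; move: (le_trans tN Nn); rewrite leNgt nt.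
Qed.

End Paths.

Section HawkesPaths.
Set Implicit Arguments.
Unset Strict Implicit.
Context {d : measure_display} {T : measurableType d} {R : realType}.
Variables (tau : nat -> T -> R) (w : T).
Hypothesis tau_incr : forall n, tau n w < tau n.+1 w.
Hypothesis tau_oo : tau n w @[n --> \oo] --> +oo.

(** Counts and epochs are inverse to each other. This turns every event about counts into
    comparisons of single epochs, which settles measurability. *)
Lemma ltn_arrivals t n : (n < arrivals tau t w)%N = (tau n w <= t).
Proof.
have [N HN] := epoch_count tau_incr tau_oo t.
rewrite /arrivals (_ : [set i | _] = `I_N); last first.
  by apply/seteqP; split => i /=; rewrite HN.
rewrite fset_set_II card_imfset/=; last exact: val_inj.
by rewrite size_enum_ord HN.
Qed.

(** The number of terms depends on the path, hence a bound valid from some [N] on: the intensity is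
    the limit of eventually constant finite sums, which serves both its measurability and its
    comparison with a series. *)
Lemma intensity_sum (lam r t : R) (B : nat -> T -> R) : exists N, forall M, (N <= M)%N ->
  intensity lam r tau B t w =
  lam + \sum_(i < M) B i w * (expR (- r * t) * exp_lt r t (tau i w)).
Proof.
have [N HN] := epoch_count_lt tau_incr tau_oo t.
exists N => M NM; rewrite /intensity; congr (_ + _).
rewrite (fsbig_ord _ M (fun i => B i w * (expR (- r * t) * exp_lt r t (tau i w)))).
rewrite -(fsbig_widen [set i | tau i w < t]); last 2 first.
- by move=> i /=; rewrite -HN => /leq_trans; exact.
- by move=> i /= [_ /negP]; rewrite /exp_lt => /negbTE ->; rewrite !mulr0.
apply: eq_fsbigr => i; rewrite inE /exp_lt => /= ->.
by rewrite -expRD; congr (_ * expR _); ring.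
Qed.

Lemma in_system_sum (S : nat -> T -> R) t :
  ((in_system tau S t w)%:R%:E =
   \sum_(n <oo) ((tau n w <= t < tau n w + S n w)%R%:R%:E : \bar R))%E.
Proof.
have [N HN] := epoch_count tau_incr tau_oo t.
rewrite (@eseries_finite_support _ (fun n => (tau n w <= t < tau n w + S n w)%R%:R) N); last first.
  by move=> n; rewrite leqNgt HN => /negbTE ->.
congr (_%:E); rewrite /in_system.
set A := [set i | _].
have AN : A `<=` `I_N by move=> i /= /andP[]; rewrite -HN.
rewrite (fsbig_ord _ N (fun n => (tau n w <= t < tau n w + S n w)%R%:R)).
rewrite -(fsbig_widen A)//; last first.
  by move=> i /= [_ /negP/negbTE ->].
rewrite (eq_fsbigr (fun=> 1)); last by move=> i; rewrite inE /A/= => ->.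
rewrite fsbig_finite/=; last exact: sub_finite_set (finite_II N).
by rewrite big_const_seq count_predT cardfE iter_addr_0.
Qed.

End HawkesPaths.

(** * Consequences of a conditional expansion *)

Section CondProbExpansion.
Set Implicit Arguments.
Unset Strict Implicit.
Context {d : measure_display} {T : measurableType d} {R : realType}.
Variables (P : probability T R) (F : set (set T)) (E : R -> set T) (g : R -> T -> R).
Hypothesis Eg : cond_prob_expansion P F E g.

(** [g] is [c] minus [c - g]. The first is integrable by definition, the second for small [h], since
    an extended real that tends to 0 is eventually finite. *)
Lemma cond_prob_expansion_integrable : (forall h, measurable_fun setT (g h)) ->
  \forall h \near 0^'+, P.-integrable setT (EFin \o g h).
Proof.
move=> mg; have [c [cP]] := Eg.
move=> /fine_cvgP[fin _].
near=> h.
have h0 : 0 < h by [].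
have [_ ic _] := cP h h0.
have : ((h^-1)%:E * 'E_P[fun w => `|c h w - g h w|%R])%E \is a fin_num by near: h.
rewrite unlock => hfin.
have mc : measurable_fun setT (c h) by exact/measurable_EFinP/(measurable_int P).
have mcg : measurable_fun setT (fun w => c h w - g h w) by exact: measurable_funB.
have icg : P.-integrable setT (fun w => (c h w - g h w)%:E).
  apply/integrableP; split; first exact/measurable_EFinP.
  rewrite ltey; apply/negP => /eqP cgoo.
  by move: hfin; rewrite [X in (_ * X)%E]cgoo gt0_muley// lte_fin invr_gt0.
apply: (@eq_integrable _ _ _ P _ measurableT (fun w => (c h w)%:E - (c h w - g h w)%:E)%E).
  by move=> w _ /=; rewrite -EFinB; congr (_%:E); ring.
exact: integrableB.
Unshelve. all: by end_near. Qed.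

(** Over an event [A] of [F] the version [c] integrates to the probability of [A] and [E h]
    together, so the error is the integral of [c - g] over [A], at most its L^1 norm on the whole
    space. *)
Lemma cond_prob_expansion_cvg A : measurable A -> F A ->
  (forall h, 0 < h -> P.-integrable setT (EFin \o g h)) ->
  h^-1 * (fine (P (A `&` E h)) - fine (\int[P]_(w in A) (g h w)%:E)%E)
    @[h --> 0^'+] --> 0.
Proof.
move=> mA FA ig; have [c [cP]] := Eg.
move=> /fine_cvgP[fin c0].
apply/norm_cvg0P; apply: squeeze_cvgr (cvg_cst 0) c0.
near=> h; rewrite normr_ge0/=.
have h0 : 0 < h by [].
have [_ ic <-//] := cP h h0.
have icg : P.-integrable setT (fun w => (c h w - g h w)%:E).
  have := integrableB measurableT ic (ig h h0).
  by apply: eq_integrable.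
have icgA := integrableS measurableT mA (@subsetT _ A) icg.
have := @RintegralB _ _ _ P _ (c h) (g h) mA
  (integrableS measurableT mA (@subsetT _ A) ic)
  (integrableS measurableT mA (@subsetT _ A) (ig h h0)).
rewrite /Rintegral => <-.
rewrite normrM gtr0_norm ?invr_gt0// unlock fineM//; last first.
  exact/integrable_fin_num/integrable_norm.
rewrite ler_pM2l ?invr_gt0//.
apply: (le_trans (le_normr_Rintegral mA icgA)).
apply: fine_le.
- exact/integrable_fin_num/integrable_norm.
- exact/integrable_fin_num/integrable_norm.
apply: ge0_subset_integral => //.
by apply: (measurable_int P); exact: integrable_norm.
Unshelve. all: by end_near. Qed.

End CondProbExpansion.

(** With [p] and [q] the counts at [t] and [t + h], [p <= n < q] says that the epoch of index [n]
    falls in the window. A lone arrival has index [p], so it is counted as soon as [p <= N], that is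
    [t < tau N], an event of the history at [t]. *)
Lemma count_window (p q N : nat) :
  ((p <= N) && (q - p == 1) <= \sum_(n < N.+1) (p <= n < q))%N.
Proof.
case: (leqP p N) => //= pN; case: eqP => // qp.
rewrite (bigD1 (Ordinal (pN : (p < N.+1)%N)))//= leqnn/=.
have -> : (p < q)%N by rewrite -subn_gt0 qp.
exact: leq_addr.
Qed.

(** A lone arrival contributes at most one index. With several, the crude bound by the number [N.+1]
    of summands suffices, their probability being [o(h)]. *)
Lemma count_window_le (p q N : nat) :
  (\sum_(n < N.+1) (p <= n < q) <= ((p <= N) && (q - p == 1)) + N.+1 * (1 < q - p))%N.
Proof.
have [pN|Np] := leqP p N; last first.
  rewrite big1// => n _; rewrite leqNgt (leq_ltn_trans _ Np)//.
  by rewrite -ltnS.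
case: (ltngtP (q - p) 1%N) => [|qp|qp] /=.
- rewrite ltnS leqn0 subn_eq0 => qp; rewrite big1// => n _.
  apply/eqP; rewrite eqb0; apply/negP => /andP[pn nq].
  by have := leq_trans nq qp; rewrite ltnNge pn.
- rewrite muln1 -[X in (_ <= _ + X)%N]card_ord -sum1_card add0n.
  by apply: leq_sum => i _; case: (_ && _).
- rewrite muln0 addn0 (bigD1 (Ordinal (pN : (p < N.+1)%N)))//= big1 ?addn0 ?leq_b1// => n np.
  apply/eqP; rewrite eqb0; apply/negP => /andP[pn nq]; move: np; rewrite -val_eqE/= neq_ltn.
  rewrite ltnNge pn/= => pn'.
  have : (1 < q - p)%N by rewrite ltn_subRL addn1 (leq_ltn_trans pn' nq).
  by rewrite qp.
Qed.

Lemma measurable_normr_EFin (R : realType) : measurable_fun setT (fun x : R => `|x|%:E).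
Proof. by apply: (measurableT_comp (f := EFin)) => //; exact: normr_measurable. Qed.

(** * The Hawkes process *)

Section Hawkes.
Set Implicit Arguments.
Unset Strict Implicit.
Context {d : measure_display} {T : measurableType d} {R : realType}.
Variable P : probability T R.
Context {d0 : measure_display} {T0 : measurableType d0} {P0 : probability T0 R}.
Variables (B0 : {RV P0 >-> R}) (lam r b1 : R) (tau B : nat -> {RV P >-> R}).
Hypotheses (lam_gt0 : 0 < lam) (r_gt0 : 0 < r).
Hypothesis B0_gt0 : P0 [set w | 0 < B0 w] = 1%E.
Hypothesis B0_mean : 'E_P0[B0]%E = b1%:E.
Hypothesis hawkes : is_hawkes B0 lam r tau B.

Let tau_incr w n : tau n w < tau n.+1 w.
Proof. exact: epoch_increasing hawkes _ _. Qed.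

Let tau_oo w : tau n w @[n --> \oo] --> +oo.
Proof. exact: epoch_nonexplosive hawkes _. Qed.

Lemma epoch_gt0n n w : 0 < tau n w.
Proof.
by apply: lt_le_trans (epoch_gt0 hawkes w) _; apply: (epoch_le (x := tau ^~ w)).
Qed.

Lemma measurable_mark0_gt0 : measurable [set w | 0 < B0 w].
Proof.
rewrite [X in measurable X](_ : _ = B0 @^-1` `]0, +oo[); last first.
  by apply/seteqP; split => w /=; rewrite in_itv/= andbT.
by rewrite -[X in measurable X]setTI; exact: measurable_funPT.
Qed.

Lemma mark0_ae : {ae P0, forall w, 0 < B0 w}.
Proof.
exists (~` [set w | 0 < B0 w]); split => //.
  exact: measurableC measurable_mark0_gt0.
by rewrite probability_setC ?B0_gt0 ?subee//; exact: measurable_mark0_gt0.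
Qed.

Lemma mark0_abs_mean : (\int[P0]_w `|B0 w|%:E)%E = b1%:E.
Proof.
rewrite -B0_mean unlock; apply: ae_eq_integral => //.
- by apply/measurable_EFinP/measurableT_comp.
- exact/measurable_EFinP.
- by apply: filterS mark0_ae => w w0 _; rewrite gtr0_norm.
Qed.

(** Otherwise the absolute mark would have integral 0 and vanish almost surely. Positivity lets [b1]
    be divided out, both to exclude atoms and to bound [epoch_series r]. *)
Lemma mark_mean_gt0 : 0 < b1.
Proof.
have : (0 <= b1%:E)%E by rewrite -mark0_abs_mean; apply: integral_ge0.
rewrite lee_fin le_eqVlt => /predU1P[b10|//].
have mB0 : measurable_fun setT (EFin \o B0) by exact/measurable_EFinP.
have [+ _] := ae_eq_integral_abs P0 measurableT mB0.
rewrite /= mark0_abs_mean -b10 => /(_ erefl) B00.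
(* [B0] would be almost surely both zero and positive, making the whole space negligible. *)
have : P0.-negligible [set: T0].
  have : {ae P0, forall w, False}.
    near=> w.
    have w0 : 0 < B0 w by near: w; exact: mark0_ae.
    have /(_ I)[] : setT w -> (EFin \o B0) w = cst 0%E w by near: w.
    by move=> w0'; rewrite w0' ltxx in w0.
  by move=> [A [mA A0 TA]]; exists A; split => // w _; exact: TA.
move=> [A [mA A0 TA]].
have : (P0 setT <= P0 A)%E by apply: le_measure; rewrite ?inE.
by rewrite A0 probability_setT lee_fin ler10.
Unshelve. all: by end_near. Qed.

Lemma integral_mark (f : R -> \bar R) n : measurable_fun setT f -> (forall x, 0 <= f x)%E ->
  (\int[P]_w f (B n w) = \int[P0]_w f (B0 w))%E.
Proof.
move=> mf f0.
rewrite -[LHS](@ge0_integral_distribution _ _ _ _ _ P (B n))//.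
rewrite -[RHS](@ge0_integral_distribution _ _ _ _ _ P0 B0)//.
by apply: eq_measure_integral => A mA _; exact: (mark_distribution hawkes).
Qed.

Lemma mark_ae : {ae P, forall w n, 0 < B n w}.
Proof.
apply: ae_foralln => n.
have mB : measurable [set w | 0 < B n w].
  rewrite [X in measurable X](_ : _ = B n @^-1` `]0, +oo[); last first.
    by apply/seteqP; split => w /=; rewrite in_itv/= andbT.
  by rewrite -[X in measurable X]setTI; exact: measurable_funPT.
exists (~` [set w | 0 < B n w]); split => //; first exact: measurableC.
transitivity (1 - P [set w | (0 < B n w)%R])%E; first exact: probability_setC.
suff -> : P [set w | 0 < B n w] = 1%E by rewrite subee.
have := mark_distribution hawkes n (measurable_itv `]0, +oo[).
rewrite /distribution /pushforward /= -B0_gt0.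
have eqp dd (TT : measurableType dd) (X : TT -> R) : X @^-1` `]0, +oo[ = [set w | 0 < X w].
  by apply/seteqP; split => w /=; rewrite in_itv/= andbT.
by rewrite !eqp.
Qed.

Lemma integral_mark_epoch n (g : R -> R) : measurable_fun setT g -> (forall x, 0 <= g x) ->
  (\int[P]_w (`|B n w| * g (tau n w))%:E = b1%:E * \int[P]_w (g (tau n w))%:E)%E.
Proof.
move=> mg g0.
under eq_integral do rewrite mulrC EFinM.
rewrite (@independent_integralM _ _ _ P _ _ _ _ (tau n) (B n) (EFin \o g) (fun x => `|x|%:E))//.
- rewrite (@integral_mark (fun x => `|x|%:E)) ?mark0_abs_mean 1?muleC//.
  exact: measurable_normr_EFin.
- move=> U V mU mV.
  apply: (mark_unpredictable hawkes (n := n)).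
    apply: sigma_joinl; apply: (sigma_family_preimage (X := tau)) => //=.
  exact: (sigma_family_preimage (X := B)).
- exact/measurable_EFinP.
- exact: measurable_normr_EFin.
Qed.

(* Marks are almost surely positive; taking absolute values makes [shot]
   non-negative and monotone in [g] at every point. *)
Definition shot (g : R -> R) w : \bar R :=
  (lam%:E + \sum_(n <oo) (`|B n w| * g (tau n w))%:E)%E.

Section Shot.
Variable g : R -> R.
Hypotheses (mg : measurable_fun setT g) (g0 : forall x, 0 <= g x).

Let mBg n : measurable_fun setT (fun w => (`|B n w| * g (tau n w))%:E).
Proof.
apply/measurable_EFinP/measurable_funM.
  exact: (measurableT_comp (@normr_measurable R setT)).
exact: measurableT_comp.
Qed.

Let Bg0 n w : (0 <= (`|B n w| * g (tau n w))%:E)%E.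
Proof. by rewrite lee_fin mulr_ge0. Qed.

Lemma shot_ge0 w : (0 <= shot g w)%E.
Proof. by apply: adde_ge0; [rewrite lee_fin ltW|exact: nneseries_ge0]. Qed.

Lemma measurable_shot : measurable_fun setT (shot g).
Proof. by apply: emeasurable_funD => //; exact: ge0_emeasurable_sum. Qed.

Lemma integral_shot :
  (\int[P]_w shot g w =
   lam%:E + b1%:E * \sum_(n <oo) \int[P]_w (g (tau n w))%:E)%E.
Proof.
rewrite ge0_integralD//; last 3 first.
- by move=> w _; rewrite lee_fin ltW.
- by move=> w _; exact: nneseries_ge0.
- exact: ge0_emeasurable_sum.
have -> : (\int[P]_w lam%:E = lam%:E)%E by have := expectation_cst P lam; rewrite unlock.
rewrite integral_nneseries//.
rewrite -nneseriesZl; last by move=> n _; apply: integral_ge0 => w _; rewrite lee_fin.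
by congr (_ + _)%E; apply: eq_eseriesr => n _; exact: integral_mark_epoch.
Qed.

End Shot.

Lemma le_shot g g' w : (forall x, 0 <= g x) -> (forall x, g x <= g' x) ->
  (shot g w <= shot g' w)%E.
Proof.
move=> g0 gg'; rewrite leeD2l//; apply: lee_nneseries => [n _ _|n _].
  by rewrite lee_fin mulr_ge0.
by rewrite lee_fin ler_wpM2l.
Qed.

(** Almost surely, [shot (decay_lt t)] is the intensity at [t] and [shot (decay_le t)] its right
    limit there, which includes a jump at [t]. *)
Definition decay_lt t u := expR (- r * t) * exp_lt r t u.
Definition decay_le t u := expR (- r * t) * exp_le r t u.

Lemma decay_lt_ge0 t u : 0 <= decay_lt t u.
Proof. by rewrite mulr_ge0 ?expR_ge0 ?exp_lt_ge0. Qed.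

Lemma decay_le_ge0 t u : 0 <= decay_le t u.
Proof. by rewrite mulr_ge0 ?expR_ge0 ?exp_le_ge0. Qed.

Lemma measurable_decay_lt t : measurable_fun setT (decay_lt t).
Proof. by apply: measurable_funM => //; exact: measurable_exp_lt. Qed.

Lemma measurable_decay_le t : measurable_fun setT (decay_le t).
Proof. by apply: measurable_funM => //; exact: measurable_exp_le. Qed.

Hint Resolve decay_lt_ge0 decay_le_ge0 measurable_decay_lt measurable_decay_le : core.

Lemma intensity_shot t : {ae P, forall w,
  (intensity lam r tau B t w)%:E = shot (decay_lt t) w}.
Proof.
apply: filterS mark_ae => w B_gt0.
have [N HN] := intensity_sum (tau := tau) (tau_incr w) (tau_oo w) lam r t B.
rewrite /shot (@eseries_finite_support _ (fun n => `|B n w| * decay_lt t (tau n w)) N).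
  rewrite -EFinD (HN N)//; congr (_ + _)%:E.
  by apply: eq_bigr => i _; rewrite gtr0_norm.
move=> n Nn; rewrite gtr0_norm//.
(* The sums of [n] and of [n.+1] terms both equal the intensity, so the term of index [n]
   vanishes. *)
have := HN n.+1 (leqW Nn).
by rewrite (HN n Nn) big_ord_recr/= => /addrI/eqP; rewrite -subr_eq0 opprD addNKr oppr_eq0 => /eqP.
Qed.

Lemma measurable_intensity t : measurable_fun setT (intensity lam r tau B t).
Proof.
apply: (measurable_fun_cvg (h := fun M w =>
  lam + \sum_(i < M) B i w * decay_lt t (tau i w))) => [M|w _].
  apply: measurable_funD => //; apply: measurable_sum => i.
  by apply: measurable_funM => //; exact: measurableT_comp.
have [N HN] := intensity_sum (tau := tau) (tau_incr w) (tau_oo w) lam r t B.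
apply: cvg_near_cst; near=> M; rewrite (HN M)//.
by near: M; exists N.
Unshelve. all: by end_near. Qed.

(** [hawkes_one] makes the intensity times [h] integrable for small [h > 0]; a single such [h] is
    enough, as it can be divided out. *)
Lemma integrable_intensity t : 0 <= t ->
  P.-integrable setT (EFin \o intensity lam r tau B t).
Proof.
move=> t0.
have mi h : measurable_fun setT (fun w => intensity lam r tau B t w * h).
  by apply: measurable_funM => //; exact: measurable_intensity.
have := cond_prob_expansion_integrable (hawkes_one hawkes t0) mi.
move=> H; near (0:R)^'+ => h.
have h0 : 0 < h by [].
have : P.-integrable setT (EFin \o (fun w => intensity lam r tau B t w * h)) by near: h.
move=> /(integrableZr measurableT h^-1).
apply: eq_integrable => // w _ /=.
by rewrite -EFinM mulfK// gt_eqF.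
Unshelve. all: by end_near. Qed.

Lemma integral_intensity_shot t A : measurable A ->
  (\int[P]_(w in A) (intensity lam r tau B t w)%:E = \int[P]_(w in A) shot (decay_lt t) w)%E.
Proof.
move=> mA; apply: ae_eq_integral => //.
- exact/measurable_EFinP/measurable_funTS/measurable_intensity.
- exact/measurable_funTS/measurable_shot.
by apply: filterS (intensity_shot t) => w ->.
Qed.

Lemma integral_shot_fin t : 0 <= t -> (\int[P]_w shot (decay_lt t) w)%E \is a fin_num.
Proof.
by move=> t0; rewrite -integral_intensity_shot// integrable_fin_num// integrable_intensity.
Qed.

(** ** Rates of arrival *)

Lemma measurable_epoch_le n t : measurable [set w | tau n w <= t].
Proof.
rewrite [X in measurable X](_ : _ = tau n @^-1` `]-oo, t]); last first.
  by apply/seteqP; split => w /=; rewrite in_itv.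
by rewrite -[X in measurable X]setTI; exact: measurable_funPT.
Qed.

Lemma measurable_epoch_gt n t : measurable [set w | t < tau n w].
Proof.
rewrite [X in measurable X](_ : _ = ~` [set w | tau n w <= t]); last first.
  by apply/seteqP; split => w /=; rewrite ltNge => /negP.
exact/measurableC/measurable_epoch_le.
Qed.

Lemma measurable_epoch_window n s t : measurable [set w | s < tau n w <= t].
Proof.
rewrite [X in measurable X](_ : _ = [set w | s < tau n w] `&` [set w | tau n w <= t]).
  by apply: measurableI; [exact: measurable_epoch_gt|exact: measurable_epoch_le].
by apply/seteqP; split => w /=; [move/andP|move=> ?; apply/andP].
Qed.

Lemma measurable_epoch_eq n t : measurable [set w | tau n w = t].
Proof.
by rewrite [X in measurable X](_ : _ = tau n @^-1` [set t]).
Qed.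

Lemma ltn_arrivalsE t w n : (n < arrivals tau t w)%N = (tau n w <= t).
Proof. exact: (ltn_arrivals (tau := tau) (tau_incr w) (tau_oo w)). Qed.

Lemma arrivals_leqE t w n : (arrivals tau t w <= n)%N = (t < tau n w).
Proof. by rewrite leqNgt ltn_arrivalsE -ltNge. Qed.

Lemma measurable_arrivals t k : measurable [set w | arrivals tau t w = k].
Proof.
case: k => [|k].
  rewrite [X in measurable X](_ : _ = [set w | t < tau 0%N w]).
    exact: measurable_epoch_gt.
  by apply/seteqP; split => w /=; rewrite -arrivals_leqE leqn0 => /eqP.
rewrite [X in measurable X](_ : _ = [set w | t < tau k.+1 w] `&` [set w | tau k w <= t]).
  by apply: measurableI; [exact: measurable_epoch_gt|exact: measurable_epoch_le].
apply/seteqP; split => w /=; rewrite -arrivals_leqE -ltn_arrivalsE.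
  by move=> ->.
by move=> [? ?]; apply/eqP; rewrite eqn_leq; apply/andP.
Qed.

Lemma measurable_arrivals2 (Q : nat -> nat -> bool) s t :
  measurable [set w | Q (arrivals tau s w) (arrivals tau t w)].
Proof.
rewrite [X in measurable X](_ : _ = \bigcup_i \bigcup_(j in [set j | Q i j])
    ([set w | arrivals tau s w = i] `&` [set w | arrivals tau t w = j])).
  apply: bigcupT_measurable => i; apply: bigcup_measurable => j _.
  by apply: measurableI; exact: measurable_arrivals.
apply/seteqP; split => w /=.
  by move=> Qw; exists (arrivals tau s w) => //; exists (arrivals tau t w).
by move=> [i _ [j /= Qij [-> ->]]].
Qed.

(** The complement of a generator with [V := setT]. The one-arrival expansion will be integrated
    over these events. *)
Lemma history_epoch_gt n t : history tau B t [set w | t < tau n w].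
Proof.
rewrite (_ : [set w | _] = setT `\` [set w | tau n w <= t /\ setT (B n w)]).
  have [_ + _] := @smallest_sigma_algebra _ setT [set E | exists i s (V : set R),
    [/\ s <= t, measurable V & E = [set w | tau i w <= s /\ V (B i w)]]].
  apply; apply: sub_gen_smallest.
  by exists n, t, setT; split.
apply/seteqP; split => w /=; rewrite ltNge.
  by move=> /negP tw; split => // -[].
by move=> [_ tw]; apply/negP => tw'; exact: tw.
Qed.

(** The truncation enters through [t < tau N]: at most [N] arrivals have occurred, so a lone arrival
    in the window has index at most [N]. *)
Definition one_arrival N t h : set T := [set w | t < tau N w] `&`
  [set w | (arrivals tau (t + h) w - arrivals tau t w = 1)%N].
Definition many_arrivals t h : set T :=
  [set w | (1 < arrivals tau (t + h) w - arrivals tau t w)%N].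

Lemma measurable_one_arrival N t h : measurable (one_arrival N t h).
Proof.
apply: measurableI; first exact: measurable_epoch_gt.
rewrite [X in measurable X](_ : _ =
  [set w | arrivals tau (t + h) w - arrivals tau t w == 1]%N).
  exact: (measurable_arrivals2 (fun p q => p - q == 1)%N).
by apply/seteqP; split => w /= /eqP.
Qed.

Lemma measurable_many_arrivals t h : measurable (many_arrivals t h).
Proof. exact: (measurable_arrivals2 (fun p q => 1 < p - q)%N). Qed.

Definition rate N t : R :=
  fine (\int[P]_(w in [set w | (t < tau N w)%R]) shot (decay_lt t) w)%E.

Lemma one_arrival_rate N t : 0 <= t ->
  h^-1 * fine (P (one_arrival N t h)) @[h --> 0^'+] --> rate N t.
Proof.
move=> t0.
have mA := measurable_epoch_gt N t.
have ii := integrable_intensity t0.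
have ig h : 0 < h -> P.-integrable setT (EFin \o (fun w => intensity lam r tau B t w * h)).
  by move=> h0; have := integrableZr measurableT h ii; exact: eq_integrable.
have := cond_prob_expansion_cvg (hawkes_one hawkes t0) mA (@history_epoch_gt N t) ig.
move=> /(cvgD (cvg_cst (rate N t))).
rewrite addr0; apply: cvg_trans; apply: near_eq_cvg.
near=> h; have h0 : 0 < h by [].
rewrite -[LHS]/(rate N t + h^-1 * (fine (P (one_arrival N t h)) -
  fine (\int[P]_(w in [set w | (t < tau N w)%R]) (intensity lam r tau B t w * h)%R%:E)%E)).
have -> : fine (\int[P]_(w in [set w | (t < tau N w)%R]) (intensity lam r tau B t w * h)%R%:E)%E =
    rate N t * h.
  have := @RintegralZr _ _ _ P _ (intensity lam r tau B t) h mA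
    (integrableS measurableT mA (@subsetT _ _) ii).
  by rewrite /Rintegral /rate -integral_intensity_shot//; exact.
by rewrite mulrBr mulrCA (mulVf (lt0r_neq0 h0)) mulr1 addrC subrK.
Unshelve. all: by end_near. Qed.

Lemma many_arrivals_rate t : 0 <= t ->
  h^-1 * fine (P (many_arrivals t h)) @[h --> 0^'+] --> 0.
Proof.
move=> t0.
have FT : history tau B t setT.
  have [F0 FC _] := @smallest_sigma_algebra _ setT [set E | exists i s (V : set R),
    [/\ s <= t, measurable V & E = [set w | tau i w <= s /\ V (B i w)]]].
  by rewrite -(setD0 setT); exact: FC.
have ig (h : R) : 0 < h -> P.-integrable setT (EFin \o (fun w : T => 0 : R)).
  by move=> _; exact: integrable0.
have := cond_prob_expansion_cvg (hawkes_many hawkes t0) measurableT FT ig.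
apply: cvg_trans; apply: near_eq_cvg.
by near=> h; rewrite /= setTI integral0 subr0.
Unshelve. all: by end_near. Qed.

(** * Weighted means over finitely many epochs *)

Definition epoch_mean a t n : R := \int[P]_w exp_le a t (tau n w).

Lemma exp_le_bound (a t u : R) : 0 <= a -> exp_le a t u <= expR (a * t).
Proof.
move=> a0; rewrite /exp_le; case: ifPn => [ut|_]; last exact: expR_ge0.
by rewrite ler_expR ler_wpM2l.
Qed.

Lemma integrable_exp_le a t n : 0 <= a ->
  P.-integrable setT (fun w => (exp_le a t (tau n w))%:E).
Proof.
move=> a0; apply: measurable_bounded_integrable => //=.
- by rewrite (le_lt_trans (probability_le1 _ _))// ltry.
- by apply: measurableT_comp => //; exact: measurable_exp_le.
- exists (expR (a * t)); split; first exact: num_real.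
  move=> y yt w _ /=; rewrite ger0_norm ?exp_le_ge0//.
  exact: le_trans (exp_le_bound _ _ a0) (ltW yt).
Qed.

Lemma epoch_meanE a t n : 0 <= a ->
  (\int[P]_w (exp_le a t (tau n w))%:E = (epoch_mean a t n)%:E)%E.
Proof. by move=> a0; rewrite fineK// integrable_fin_num// integrable_exp_le. Qed.

Lemma epoch_mean_ge0 a t n : 0 <= epoch_mean a t n.
Proof. by apply: Rintegral_ge0 => w _; exact: exp_le_ge0. Qed.

Definition partial_mean a N t : R := \sum_(n < N.+1) epoch_mean a t n.

Lemma Rintegral_sum_exp_le a N t : 0 <= a ->
  partial_mean a N t = \int[P]_w (\sum_(n < N.+1) exp_le a t (tau n w)).
Proof.
move=> a0; rewrite /Rintegral.
under eq_integral do rewrite -sumEFin.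
rewrite ge0_integral_sum//; last 2 first.
- by move=> n; apply: (measurable_int P); exact: integrable_exp_le.
- by move=> n w _; rewrite lee_fin exp_le_ge0.
by under eq_bigr do rewrite epoch_meanE//; rewrite sumEFin.
Qed.

Lemma integrable_sum_exp_le a N t : 0 <= a ->
  P.-integrable setT (EFin \o fun w => \sum_(n < N.+1) exp_le a t (tau n w)).
Proof.
move=> a0; have : P.-integrable setT (fun w => \sum_(n < N.+1) (exp_le a t (tau n w))%:E)%E.
  by apply: integrable_sum => // n _; exact: integrable_exp_le.
by apply: eq_integrable => // w _ /=; rewrite sumEFin.
Qed.

Lemma Rintegral_indic A : measurable A -> \int[P]_w (\1_A w) = fine (P A).
Proof. by move=> mA; rewrite /Rintegral integral_indic// setIT. Qed.

Lemma integrable_indicP A : measurable A -> P.-integrable setT (EFin \o \1_A : T -> \bar R).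
Proof.
by move=> mA; apply: integrable_indic => //; rewrite (le_lt_trans (probability_le1 _ _))// ltry.
Qed.

Lemma exp_le_incr (a t h u : R) : 0 <= a -> 0 < h ->
  expR (a * t) * (t < u <= t + h)%R%:R <= exp_le a (t + h) u - exp_le a t u
    <= expR (a * (t + h)) * (t < u <= t + h)%R%:R.
Proof.
move=> a0 h0; rewrite /exp_le; have [ut|tu] := leP u t.
  by rewrite (le_trans ut) ?lerDl ?(ltW h0)// subrr !mulr0 lexx.
have [uth|thu] := leP u (t + h); last by rewrite subrr !mulr0 lexx.
by rewrite !mulr1 subr0 !ler_expR !ler_wpM2l// ltW.
Qed.

Lemma epoch_window t h n w : (t < tau n w <= t + h) =
  (arrivals tau t w <= n < arrivals tau (t + h) w)%N.
Proof. by rewrite arrivals_leqE ltn_arrivalsE. Qed.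

Lemma one_arrivalE N t h w :
  \1_(one_arrival N t h) w = ((arrivals tau t w <= N) &&
    (arrivals tau (t + h) w - arrivals tau t w == 1))%N%:R :> R.
Proof.
rewrite indicE arrivals_leqE; congr (_%:R); congr nat_of_bool.
apply/idP/idP => [|/andP[tN /eqP d1]]; rewrite inE; last by split.
by move=> [/= -> ->].
Qed.

Lemma many_arrivalsE t h w : \1_(many_arrivals t h) w =
  (1 < arrivals tau (t + h) w - arrivals tau t w)%N%:R :> R.
Proof.
rewrite indicE; congr (_%:R); congr nat_of_bool.
by apply/idP/idP; rewrite inE.
Qed.

(** As [a >= 0], each epoch in the window adds between [exp(a t)] and [exp(a (t + h))]. The counting
    inequality holds path by path and is then integrated; the upper bound below is obtained
    likewise. *)
Lemma partial_mean_incr_ge a N t h : 0 <= a -> 0 < h ->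
  expR (a * t) * fine (P (one_arrival N t h)) <=
  partial_mean a N (t + h) - partial_mean a N t.
Proof.
move=> a0 h0; have m1 := measurable_one_arrival N t h.
have i1 : P.-integrable setT (EFin \o fun w => expR (a * t) * \1_(one_arrival N t h) w).
  by have := integrableZl measurableT (expR (a * t)) (integrable_indicP m1); exact: eq_integrable.
rewrite lerBrDr !Rintegral_sum_exp_le// -Rintegral_indic//.
rewrite -RintegralZl//; last exact: integrable_indicP.
rewrite -RintegralD//; last exact: integrable_sum_exp_le.
apply: le_Rintegral => //.
- have := integrableD measurableT i1 (integrable_sum_exp_le N t a0).
  exact: eq_integrable.
- exact: integrable_sum_exp_le.
move=> w _; rewrite -lerBrDr -sumrB one_arrivalE.
apply: (@le_trans _ _ (\sum_(n < N.+1) expR (a * t) * (t < tau n w <= t + h)%R%:R)); last first.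
  by apply: ler_sum => n _; case/andP: (exp_le_incr t (tau n w) a0 h0).
rewrite -mulr_sumr ler_wpM2l ?expR_ge0//.
under eq_bigr do rewrite epoch_window.
by rewrite -natr_sum ler_nat count_window.
Qed.

Lemma partial_mean_incr_le a N t h : 0 <= a -> 0 < h ->
  partial_mean a N (t + h) - partial_mean a N t <=
  expR (a * (t + h)) * (fine (P (one_arrival N t h)) + N.+1%:R * fine (P (many_arrivals t h))).
Proof.
move=> a0 h0; have m1 := measurable_one_arrival N t h.
have m2 := measurable_many_arrivals t h.
have i2 : P.-integrable setT (EFin \o fun w => N.+1%:R * \1_(many_arrivals t h) w).
  by have := integrableZl measurableT N.+1%:R (integrable_indicP m2); exact: eq_integrable.
have i12 : P.-integrable setT (EFin \o fun w =>
    \1_(one_arrival N t h) w + N.+1%:R * \1_(many_arrivals t h) w).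
  by have := integrableD measurableT (integrable_indicP m1) i2; exact: eq_integrable.
rewrite !Rintegral_sum_exp_le// -!Rintegral_indic//.
rewrite -RintegralB//; try exact: integrable_sum_exp_le.
rewrite -RintegralZl//; last exact: integrable_indicP.
rewrite -RintegralD//; last exact: integrable_indicP.
rewrite -RintegralZl//.
apply: le_Rintegral => //.
- have := integrableB measurableT (integrable_sum_exp_le N (t + h) a0)
    (integrable_sum_exp_le N t a0).
  exact: eq_integrable.
- have := integrableZl measurableT (expR (a * (t + h))) i12; exact: eq_integrable.
move=> w _; rewrite -sumrB one_arrivalE many_arrivalsE.
apply: (@le_trans _ _ (\sum_(n < N.+1) expR (a * (t + h)) * (t < tau n w <= t + h)%R%:R)).
  by apply: ler_sum => n _; case/andP: (exp_le_incr t (tau n w) a0 h0).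
rewrite -mulr_sumr ler_wpM2l ?expR_ge0//.
under eq_bigr do rewrite epoch_window.
by rewrite -natr_sum -natrM -natrD ler_nat count_window_le.
Qed.

Lemma partial_mean_rderiv a N t : 0 <= a -> 0 <= t ->
  rderiv (partial_mean a N) t (expR (a * t) * rate N t).
Proof.
move=> a0 t0; rewrite /rderiv.
apply: (@squeeze_cvgr _ _ _ _
  (fun h => expR (a * t) * (h^-1 * fine (P (one_arrival N t h))))
  (fun h => expR (a * (t + h)) * (h^-1 * fine (P (one_arrival N t h)) +
     N.+1%:R * (h^-1 * fine (P (many_arrivals t h)))))).
- near=> h; have h0 : 0 < h by [].
  rewrite mulrCA ler_pM2l ?invr_gt0// partial_mean_incr_ge//=.
  rewrite [N.+1%:R * (_ * _)]mulrCA -mulrDr mulrCA ler_pM2l ?invr_gt0//.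
  exact: partial_mean_incr_le.
- by apply: cvgM; [exact: cvg_cst|exact: one_arrival_rate].
- rewrite -[rate N t]addr0 -[in X in _ + X](mulr0 N.+1%:R).
  apply: cvgM.
  exact: (rderiv_right_cvg (u := fun x => expR (a * x)) (@rderiv_expR R a t)).
  apply: cvgD; first exact: one_arrival_rate.
  by apply: cvgM; [exact: cvg_cst|exact: many_arrivals_rate].
Unshelve. all: by end_near. Qed.

(** ** Absence of atoms *)

Lemma decay_lt_ge s t u : s < t ->
  expR (- r * (t - s)) * decay_le s u <= decay_lt t u.
Proof.
move=> st; rewrite /decay_le /decay_lt /exp_le /exp_lt.
have [us|su] := leP u s; last first.
  by rewrite !mulr0 mulr_ge0 ?expR_ge0 ?exp_lt_ge0.
rewrite (le_lt_trans us st) mulrA -expRD.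
by rewrite (_ : _ + _ = - r * t)//; ring.
Qed.

(** The base rate [lam] is left unscaled on the right, and [c <= 1] takes care of it. *)
Lemma shot_scale c g w : 0 <= c <= 1 -> (forall x, 0 <= g x) ->
  (c%:E * shot g w <= shot (fun u => (c * g u)%R) w)%E.
Proof.
move=> /andP[c0 c1] g0; rewrite /shot ge0_muleDr ?lee_fin ?(ltW lam_gt0)//; last first.
  by apply: nneseries_ge0 => n _ _; rewrite lee_fin mulr_ge0.
rewrite -nneseriesZl; last by move=> n _; rewrite lee_fin mulr_ge0.
apply: leeD; first by rewrite -EFinM lee_fin ler_piMl// ltW.
apply: lee_nneseries => [n _ _|n _].
  by rewrite -EFinM lee_fin !mulr_ge0.
by rewrite -EFinM lee_fin mulrCA.
Qed.

Lemma shot_lt_ge s t w : s < t ->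
  ((expR (- r * (t - s)))%:E * shot (decay_le s) w <= shot (decay_lt t) w)%E.
Proof.
move=> st.
have c01 : 0 <= expR (- r * (t - s)) <= 1.
  rewrite expR_ge0/= -expR0 ler_expR mulNr oppr_le0 mulr_ge0// ltW//.
  by rewrite subr_gt0.
apply: (le_trans (shot_scale w c01 (decay_le_ge0 s))).
apply: le_shot => u; first by rewrite mulr_ge0 ?expR_ge0.
exact: decay_lt_ge.
Qed.

Let measurable_shot_le s A : measurable_fun A (shot (decay_le s)).
Proof. exact/measurable_funTS/measurable_shot. Qed.

Let measurable_shot_lt s A : measurable_fun A (shot (decay_lt s)).
Proof. exact/measurable_funTS/measurable_shot. Qed.

Let shot_le_ge0 s w : (0 <= shot (decay_le s) w)%E.
Proof. exact: shot_ge0. Qed.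

Let shot_lt_ge0 s w : (0 <= shot (decay_lt s) w)%E.
Proof. exact: shot_ge0. Qed.

Hint Resolve measurable_shot_le measurable_shot_lt shot_le_ge0 shot_lt_ge0 : core.

Lemma integral_shot_lt_fin t A : 0 <= t -> measurable A ->
  (\int[P]_(w in A) shot (decay_lt t) w)%E \is a fin_num.
Proof.
move=> t0 mA; rewrite ge0_fin_numE ?integral_ge0//.
apply: (@le_lt_trans _ _ (\int[P]_w shot (decay_lt t) w)%E).
  exact: ge0_subset_integral.
by rewrite -ge0_fin_numE ?integral_ge0// integral_shot_fin.
Qed.

Lemma integral_shot_lt_ge s t A : s < t -> measurable A ->
  ((expR (- r * (t - s)))%:E * \int[P]_(w in A) shot (decay_le s) w <=
   \int[P]_(w in A) shot (decay_lt t) w)%E.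
Proof.
move=> st mA; rewrite -ge0_integralZl//.
apply: ge0_le_integral => //.
- by move=> w _; rewrite mule_ge0// lee_fin expR_ge0.
- by apply: emeasurable_funM => //; exact: measurable_cst.
- by move=> w _; exact: shot_lt_ge.
Qed.

Lemma integral_shot_le_fin s A : 0 <= s -> measurable A ->
  (\int[P]_(w in A) shot (decay_le s) w)%E \is a fin_num.
Proof.
move=> s0 mA; rewrite ge0_fin_numE ?integral_ge0// ltey.
apply/negP => /eqP oo.
(* One unit of time later the arrivals at [s] belong to the strict past and have only lost a factor
   [exp(- r)], so finiteness at [s + 1] is inherited at [s]. *)
have s1 : s < s + 1 by rewrite ltrDl.
have := integral_shot_lt_ge s1 mA.
rewrite oo gt0_muley ?lte_fin ?expR_gt0// leye_eq => /eqP.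
by have /fin_numP[_ /eqP] := integral_shot_lt_fin (ltW (le_lt_trans s0 s1)) mA.
Qed.

Lemma rate_ge0 N t : 0 <= rate N t.
Proof. by apply: fine_ge0; exact: integral_ge0. Qed.

Lemma partial_mean_nd a N s t : 0 <= a -> s <= t ->
  partial_mean a N s <= partial_mean a N t.
Proof.
move=> a0; rewrite le_eqVlt => /predU1P[->//|st].
have ts : 0 < t - s by rewrite subr_gt0.
have := partial_mean_incr_ge N s a0 ts.
rewrite [s + _]addrC subrK => incr.
rewrite -subr_ge0; apply: le_trans incr.
by rewrite mulr_ge0 ?expR_ge0 ?fine_ge0.
Qed.

(* Just after [s] the rate is at least the one computed with the arrivals at
   [s] included, and the right derivative at [s] has to account for it. *)
Lemma rate_right_bound N s t1 : 0 <= s -> s < t1 ->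
  expR (- r * (t1 - s)) *
    fine (\int[P]_(w in [set w | (t1 < tau N w)%R]) shot (decay_le s) w)%E <= rate N s.
Proof.
move=> s0 st1; set K := _ * _.
have K0 : 0 <= K by rewrite mulr_ge0 ?expR_ge0// fine_ge0// integral_ge0.
(* Up to [t1] the arrivals up to and including [s] keep at least the share [exp(- r (t1 - s))], and
   [t1 < tau N] implies [t < tau N]. *)
have rateK t : s < t -> t <= t1 -> K <= rate N t.
  move=> st tt1; have t0 : 0 <= t by rewrite (le_trans s0)// ltW.
  rewrite -lee_fin /rate fineK; last first.
    exact/integral_shot_lt_fin/measurable_epoch_gt.
  rewrite EFinM fineK; last exact/integral_shot_le_fin/measurable_epoch_gt.
  apply: (@le_trans _ _ (\int[P]_(w in [set w | (t1 < tau N w)%R]) shot (decay_lt t) w)%E).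
    apply: le_trans (integral_shot_lt_ge st (measurable_epoch_gt N t1)).
    rewrite lee_wpmul2r ?integral_ge0// lee_fin ler_expR !mulNr lerN2.
    by rewrite ler_pM2l// lerB.
  apply: ge0_subset_integral => //; try exact: measurable_epoch_gt.
  by move=> w /=; exact: le_lt_trans.
have incr y : s < y -> y <= t1 -> K * (y - s) <= partial_mean 0 N y - partial_mean 0 N s.
  move=> sy yt1; apply/ler_addgt0Pr => e e0.
  have K1 : 0 < K + 1 by rewrite ltr_wpDl.
  (* [rateK] covers only times after [s], so [rderiv_ge] starts from a nearby [x > s]; the choice
     makes the lost piece [K * (x - s)] at most [e]. *)
  pose x := s + Num.min (y - s) (e / (K + 1)).
  have sx : s < x by rewrite ltrDl lt_min subr_gt0 sy divr_gt0.
  have xy : x <= y by rewrite /x addrC -lerBrDr ge_min lexx.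
  have : K * (y - x) <= partial_mean 0 N y - partial_mean 0 N x.
    apply: (@rderiv_ge _ _ (fun t => expR (0 * t) * rate N t)) => //.
      (* Monotonicity provides the left condition; continuity will only follow from the absence of
         atoms, which this bound serves to prove. *)
      move=> c cy e' e'0; near=> z.
      rewrite (@le_trans _ _ (partial_mean 0 N c))//; last by rewrite lerDl ltW.
      by apply: partial_mean_nd => //; apply: ltW; near: z; exact: nbhs_left_lt.
    move=> z /andP[xz zy]; have sz := lt_le_trans sx xz; split.
      by apply: partial_mean_rderiv => //; rewrite (le_trans s0)// ltW.
    by rewrite mul0r expR0 mul1r rateK// (le_trans (ltW zy)).
  have : partial_mean 0 N s <= partial_mean 0 N x.
    by apply: partial_mean_nd => //; exact: ltW.
  have : K * (x - s) <= e.
    have -> : x - s = Num.min (y - s) (e / (K + 1)) by rewrite /x addrC addKr.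
    apply: (@le_trans _ _ ((K + 1) * (e / (K + 1)))); last by rewrite mulrC divfK ?gt_eqF.
    by apply: ler_pM => //; [rewrite le_min subr_ge0 ltW//= divr_ge0 ?ltW|
      rewrite lerDl|rewrite ge_min lexx orbT].
  have -> : K * (y - s) = K * (y - x) + K * (x - s) by ring.
  lra.
(* With weight [a = 0] the right derivative at [s] is [rate N s] itself. *)
have := @partial_mean_rderiv 0 N s (lexx 0) s0.
rewrite mul0r expR0 mul1r => H.
apply: (cvgr_to_ge H); near=> h.
have h0 : 0 < h by [].
have : K * (s + h - s) <= partial_mean 0 N (s + h) - partial_mean 0 N s.
  apply: incr; first by rewrite ltrDl.
  rewrite addrC -lerBrDr; near: h; apply: nbhs_right_le.
  by rewrite subr_gt0.
by rewrite addrAC subrr add0r mulrC -ler_pdivlMl.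
Unshelve. all: by end_near. Qed.

(** [rate_right_bound] as [t1] decreases to [s]: the exponential factor tends to 1 and the events
    [t1 < tau N] increase to [s < tau N]. *)
Lemma rate_right N s : 0 <= s ->
  (\int[P]_(w in [set w | (s < tau N w)%R]) shot (decay_le s) w <=
   \int[P]_(w in [set w | (s < tau N w)%R]) shot (decay_lt s) w)%E.
Proof.
move=> s0.
pose F n := [set w | s + n.+1%:R^-1 < tau N w].
have mF n : measurable (F n) by exact: measurable_epoch_gt.
have FE : \bigcup_n F n = [set w | s < tau N w].
  apply/seteqP; split => w /=.
    by move=> [n _ /=]; apply: lt_trans; rewrite ltrDl invr_gt0.
  move=> sw; have tws : 0 < tau N w - s by rewrite subr_gt0.
  have [n _ Hn] := near_infty_natSinv_lt (PosNum tws).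
  by exists n => //; rewrite /F/= addrC -ltrBrDr; apply: Hn => /=.
have /fine_cvgP[_ cF] : (\int[P]_(w in F n) shot (decay_le s) w @[n --> \oo] -->
    (fine (\int[P]_(w in [set w | (s < tau N w)%R]) shot (decay_le s) w))%:E)%E.
  rewrite fineK; last exact/integral_shot_le_fin/measurable_epoch_gt.
  rewrite -FE; apply: ge0_nondecreasing_set_cvg_integral => //.
  move=> n m nm; apply/subsetPset => w /=; rewrite /F/=; apply: le_lt_trans.
  by rewrite lerD2l lef_pV2 ?posrE// ler_nat.
rewrite -[leLHS]fineK; last exact/integral_shot_le_fin/measurable_epoch_gt.
rewrite -[leRHS]fineK; last exact/integral_shot_lt_fin/measurable_epoch_gt.
rewrite lee_fin.
have : expR (- r * n.+1%:R^-1) @[n --> \oo] --> expR (- r * 0).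
  apply: continuous_cvg; first exact: continuous_expR.
  by apply: cvgM; [exact: cvg_cst|exact: (@cvg_harmonic R)].
rewrite mulr0 expR0 => cE.
have H : expR (- r * n.+1%:R^-1) * fine (\int[P]_(w in F n) shot (decay_le s) w)%E
    @[n --> \oo] --> fine (\int[P]_(w in [set w | (s < tau N w)%R]) shot (decay_le s) w)%E.
  by rewrite -[X in _ --> X]mul1r; exact: cvgM.
apply: (cvgr_to_le H); near=> n.
have := @rate_right_bound N s (s + n.+1%:R^-1) s0.
by rewrite addrAC subrr add0r; apply; rewrite ltrDl invr_gt0.
Unshelve. all: by end_near. Qed.

(** The kernels differ only at an epoch equal to [s], where the decay factor is 1. The gap is the
    total absolute mark arriving at [s], of which one term is kept. *)
Lemma shot_jump s k w :
  (shot (decay_lt s) w + (`|B k w| * (tau k w == s)%:R)%:E <= shot (decay_le s) w)%E.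
Proof.
have -> : shot (decay_le s) w = (shot (decay_lt s) w +
    \sum_(n <oo) (`|B n w| * (tau n w == s)%:R)%:E)%E.
  rewrite /shot -addeA; congr (_ + _)%E.
  rewrite -nneseriesD; last 2 first.
  - by move=> n _ _; rewrite lee_fin mulr_ge0.
  - by move=> n _ _; rewrite lee_fin mulr_ge0.
  apply: eq_eseriesr => n _; rewrite -EFinD -mulrDr; congr (_ * _)%:E.
  rewrite /decay_le /decay_lt /exp_le /exp_lt le_eqVlt.
  have [->|_] := eqVneq (tau n w) s => /=; last by rewrite addr0.
  by rewrite ltxx mulr0 add0r -expRD mulNr addNr expR0.
rewrite leeD2l//.
rewrite (@nneseriesD1 _ _ k)//.
by apply: leeDl; apply: nneseries_ge0 => n _ _; rewrite lee_fin mulr_ge0.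
Qed.

(** By [rate_right] the mean absolute mark that customer [k] brings at time [s] is at most 0. Mark
    and epoch being independent, this mean is [b1] times the mass of the atom. *)
Lemma epoch_no_atom k s : 0 <= s -> P [set w | tau k w = s] = 0%E.
Proof.
(* The index is [k.+1] because [tau k = s] forces the next epoch beyond [s], so [A] contains the
   atom; with index [k] it would miss it. *)
move=> s0; pose A := [set w | s < tau k.+1 w].
have mA : measurable A by exact: measurable_epoch_gt.
have mj : measurable_fun setT (fun u : R => (u == s)%:R : R).
  rewrite (_ : (fun _ => _) = \1_[set s]); last first.
    apply/funext => u; rewrite indicE; congr (_%:R); congr nat_of_bool.
    by apply/eqP/idP; rewrite inE.
  by apply: measurable_indic.
pose j w := (`|B k w| * (tau k w == s)%:R)%:E : \bar R.
have j0 w : (0 <= j w)%E by rewrite lee_fin mulr_ge0.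
have mjw : measurable_fun setT j.
  apply/measurable_EFinP/measurable_funM.
    exact: (measurableT_comp (@normr_measurable R setT)).
  exact: (measurableT_comp mj).
have : (\int[P]_(w in A) j w <= 0)%E.
  rewrite -(leeD2lE (x := \int[P]_(w in A) shot (decay_lt s) w)%E);
    last exact: integral_shot_lt_fin.
  rewrite adde0 -ge0_integralD//; last exact: measurable_funTS.
  apply: le_trans (rate_right k.+1 s0).
  apply: ge0_le_integral => //.
  - by move=> w _; rewrite adde_ge0.
  - by apply: emeasurable_funD => //; exact: measurable_funTS.
  - by move=> w _; exact: shot_jump.
have -> : (\int[P]_(w in A) j w = \int[P]_w j w)%E.
  rewrite integral_mkcond; apply: eq_integral => w _; rewrite patchE.
  case: ifPn => // wA; rewrite /j.
  case: eqP => [tks|]; last by rewrite mulr0.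
  by move: wA; rewrite notin_setE /A/= -tks tau_incr.
rewrite /j (@integral_mark_epoch k (fun u => (u == s)%:R))//.
have -> : (\int[P]_w (tau k w == s)%:R%:E = P [set w | tau k w = s])%E.
  have := integral_indic P measurableT (measurable_epoch_eq k s).
  rewrite setIT => <-.
  apply: eq_integral => w _; rewrite indicE; congr (_%:R%:E); congr nat_of_bool.
  by apply/eqP/idP; rewrite inE.
rewrite pmule_rle0 ?lte_fin ?mark_mean_gt0// => P0'.
by apply/eqP; rewrite eq_le P0'/=.
Qed.

(** * Left continuity of the means *)

Lemma epoch_window_small n c e : 0 <= c -> 0 < e ->
  \forall x \near c^'-, fine (P [set w | x < tau n w <= c]) <= e.
Proof.
move=> c0 e0.
(* These windows shrink to the event [tau n = c], which is null, and continuity from above makes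
   their probabilities small. *)
pose F j := [set w | c - j.+1%:R^-1 < tau n w <= c].
have mI x : measurable [set w | x < tau n w <= c] by exact: measurable_epoch_window.
have FE : \bigcap_j F j = [set w | tau n w = c].
  apply/seteqP; split => w /=; last first.
    by move=> tc j _; rewrite /F/= tc lexx andbT ltrBlDr ltrDl invr_gt0.
  move=> Fw; have /andP[_ tc] := Fw 0%N I.
  apply/eqP; rewrite eq_le tc/= leNgt; apply/negP => tlt.
  have ct : 0 < c - tau n w by rewrite subr_gt0.
  have [j _ Hj] := near_infty_natSinv_lt (PosNum ct).
  have /andP[] := Fw j I.
  by rewrite ltrBlDr -ltrBlDl ltNge => /negP; case; exact: ltW (Hj j (leqnn j)).
have : P (F j) @[j --> \oo] --> 0%E.
  rewrite -(epoch_no_atom n c0) -FE; apply: nonincreasing_cvg_mu => //.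
  - by rewrite -ge0_fin_numE// fin_num_measure//; exact: mI.
  - by move=> j; exact: mI.
  - by rewrite FE; exact: measurable_epoch_eq.
  - move=> i j ij; apply/subsetPset => w; rewrite /F/= => /andP[Fw ->]; rewrite andbT.
    by apply: le_lt_trans Fw; rewrite lerB// lef_pV2 ?posrE// ler_nat.
move=> /fine_cvgP[_ /cvgrPdist_le/(_ _ e0)[j _ Hj]].
near=> x.
have cx : c - j.+1%:R^-1 < x by near: x; apply: nbhs_left_gt; rewrite ltrBlDr ltrDl invr_gt0.
have /= := Hj j (leqnn j).
rewrite sub0r normrN ger0_norm ?fine_ge0//; apply: le_trans.
apply: fine_le.
- by apply: fin_num_measure; exact: mI.
- by apply: fin_num_measure; exact: mI.
apply: le_measure; rewrite ?inE; [exact: mI|exact: mI|].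
by move=> w /= /andP[xt tc]; rewrite /F/= tc andbT (lt_trans cx).
Unshelve. all: by end_near. Qed.

Lemma epoch_mean_nd a n s t : 0 <= a -> s <= t -> epoch_mean a s n <= epoch_mean a t n.
Proof.
move=> a0 st; apply: le_Rintegral => //; try exact: integrable_exp_le.
move=> w _; rewrite /exp_le; case: ifP => [ts|_]; last by case: ifP => // _; exact: expR_ge0.
by rewrite (le_trans ts st).
Qed.

Lemma epoch_mean_left_cvg a n c : 0 <= a -> 0 <= c ->
  epoch_mean a x n @[x --> c^'-] --> epoch_mean a c n.
Proof.
move=> a0 c0; apply/cvgrPdist_le => e e0.
(* The weight is at most [exp(a c)] on the window, whence this tolerance. *)
have e'0 : 0 < e / expR (a * c) by rewrite divr_gt0 ?expR_gt0.
near=> x; have xc : x < c by [].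
rewrite ger0_norm ?subr_ge0 ?epoch_mean_nd ?(ltW xc)//.
have mI := measurable_epoch_window n x c.
have : fine (P [set w | x < tau n w <= c]) <= e / expR (a * c).
  by near: x; exact: epoch_window_small.
rewrite ler_pdivlMr ?expR_gt0// mulrC; apply: le_trans.
rewrite -Rintegral_indic// -RintegralB//; try exact: integrable_exp_le.
rewrite -RintegralZl//; last exact: integrable_indicP.
apply: le_Rintegral => //.
- have := integrableB measurableT (integrable_exp_le c n a0) (integrable_exp_le x n a0).
  exact: eq_integrable.
- have := integrableZl measurableT (expR (a * c)) (integrable_indicP mI).
  exact: eq_integrable.
move=> w _; have cx0 : 0 < c - x by rewrite subr_gt0.
have := exp_le_incr x (tau n w) a0 cx0.
rewrite [x + _]addrC subrK => /andP[_ /le_trans]; apply.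
rewrite indicE; apply: ler_wpM2l; first exact: expR_ge0.
by rewrite ler_nat; case: (boolP (x < _ <= _)) => // H; rewrite mem_set.
Unshelve. all: by end_near. Qed.

Lemma partial_mean_left_cvg a N c : 0 <= a -> 0 <= c ->
  partial_mean a N x @[x --> c^'-] --> partial_mean a N c.
Proof.
move=> a0 c0; apply: cvg_big => [|n _]; first exact: add_continuous.
exact: epoch_mean_left_cvg.
Qed.

(** * Passage to the full series *)

Definition epoch_series a t : \bar R := (\sum_(n <oo) (epoch_mean a t n)%:E)%E.

(** An epoch at [t] itself has probability 0, so the strict kernel of the intensity may be exchanged
    for the one behind [epoch_mean]. *)
Lemma integral_decay_lt t n : 0 <= t ->
  (\int[P]_w (decay_lt t (tau n w))%:E = (expR (- r * t) * epoch_mean r t n)%:E)%E.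
Proof.
move=> t0.
have -> : (\int[P]_w (decay_lt t (tau n w))%:E = \int[P]_w (decay_le t (tau n w))%:E)%E.
  apply: ae_eq_integral => //.
  - by apply/measurable_EFinP; exact: measurableT_comp.
  - by apply/measurable_EFinP; exact: measurableT_comp.
  exists [set w | tau n w = t]; split.
  - exact: measurable_epoch_eq.
  - exact: epoch_no_atom.
  move=> w /= H; apply/eqP; apply: contra_notT H => tw _.
  by rewrite /decay_lt /decay_le /exp_lt /exp_le lt_neqAle tw.
have : (\int[P]_w ((expR (- r * t))%:E * (exp_le r t (tau n w))%:E) =
    (expR (- r * t))%:E * \int[P]_w (exp_le r t (tau n w))%:E)%E.
  rewrite ge0_integralZl//.
  - by apply: (measurable_int P); apply: integrable_exp_le; exact: ltW.
  - by move=> w _; rewrite lee_fin exp_le_ge0.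
by rewrite epoch_meanE ?(ltW r_gt0)// EFinM => <-.
Qed.

Lemma integral_shot_lt t : 0 <= t ->
  (\int[P]_w shot (decay_lt t) w =
   lam%:E + (b1 * expR (- r * t))%:E * epoch_series r t)%E.
Proof.
move=> t0; rewrite integral_shot//; congr (_ + _)%E.
under eq_eseriesr do rewrite integral_decay_lt// EFinM.
rewrite nneseriesZl; last by move=> n _; rewrite lee_fin epoch_mean_ge0.
by rewrite muleA -EFinM.
Qed.

Lemma epoch_series_ge0 a t : (0 <= epoch_series a t)%E.
Proof. by apply: nneseries_ge0 => n _ _; rewrite lee_fin epoch_mean_ge0. Qed.

Lemma epoch_series_r_fin t : 0 <= t -> epoch_series r t \is a fin_num.
Proof.
move=> t0; rewrite ge0_fin_numE ?epoch_series_ge0// ltey; apply/negP => /eqP oo.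
have := integral_shot_fin t0; rewrite integral_shot_lt// oo gt0_muley//.
by rewrite lte_fin mulr_gt0 ?expR_gt0 ?mark_mean_gt0.
Qed.

(** Comparison with the weight [r]: as epochs are positive, [exp(a u) <= exp(a t) exp(r u)] for
    every epoch [u <= t]. *)
Lemma epoch_series_fin a t : 0 <= a -> 0 <= t -> epoch_series a t \is a fin_num.
Proof.
move=> a0 t0; rewrite ge0_fin_numE ?epoch_series_ge0//.
apply: (@le_lt_trans _ _ (\sum_(n <oo) (expR (a * t))%:E * (epoch_mean r t n)%:E)%E).
  apply: lee_nneseries => [n _ _|n _]; first by rewrite lee_fin epoch_mean_ge0.
  rewrite -EFinM lee_fin /epoch_mean.
  rewrite -RintegralZl//; last by apply: integrable_exp_le; exact: ltW.
  apply: le_Rintegral => //; first exact: integrable_exp_le.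
    have := integrableZl measurableT (expR (a * t)) (integrable_exp_le t n (ltW r_gt0)).
    exact: eq_integrable.
  move=> w _; rewrite /exp_le; case: ifP => [ut|_]; last by rewrite mulr0.
  rewrite -expRD ler_expR; apply: (@le_trans _ _ (a * t)); first by rewrite ler_wpM2l.
  by rewrite lerDl mulr_ge0// ?(ltW r_gt0)// ltW// epoch_gt0n.
rewrite nneseriesZl; last by move=> n _; rewrite lee_fin epoch_mean_ge0.
by rewrite lte_mul_pinfty ?lee_fin ?expR_ge0// -ge0_fin_numE ?epoch_series_ge0// epoch_series_r_fin.
Qed.

Definition mean_sum a t : R := fine (epoch_series a t).

Lemma mean_sum_ge0 a t : 0 <= mean_sum a t.
Proof. exact/fine_ge0/epoch_series_ge0. Qed.

Lemma partial_mean_cvg a t : 0 <= a -> 0 <= t ->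
  partial_mean a N t @[N --> \oo] --> mean_sum a t.
Proof.
move=> a0 t0.
have : (\sum_(0 <= n < N) (epoch_mean a t n)%:E)%E @[N --> \oo] --> epoch_series a t.
  by apply: is_cvg_nneseries => n _ _; rewrite lee_fin epoch_mean_ge0.
rewrite -(fineK (epoch_series_fin a0 t0)) => /fine_cvgP[_].
rewrite -(cvg_shiftS (fine \o _)); apply: cvg_trans; apply: near_eq_cvg.
by near=> N; rewrite /= sumEFin/= big_mkord.
Unshelve. all: by end_near. Qed.

Lemma partial_mean_le a N t : 0 <= a -> 0 <= t -> partial_mean a N t <= mean_sum a t.
Proof.
move=> a0 t0; rewrite -lee_fin fineK ?epoch_series_fin// /partial_mean -sumEFin.
rewrite -(big_mkord xpredT (fun n => (epoch_mean a t n)%:E)).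
by apply: nneseries_lim_ge => n _ _; rewrite lee_fin epoch_mean_ge0.
Qed.

Lemma mean_sum_nd a s t : 0 <= a -> 0 <= s -> s <= t -> mean_sum a s <= mean_sum a t.
Proof.
move=> a0 s0 st; have t0 := le_trans s0 st.
apply: fine_le; try exact: epoch_series_fin.
apply: lee_nneseries => [n _ _|n _]; first by rewrite lee_fin epoch_mean_ge0.
by rewrite lee_fin epoch_mean_nd.
Qed.

Definition expected_intensity t : R := lam + b1 * expR (- r * t) * mean_sum r t.

Lemma integral_shotE t : 0 <= t -> (\int[P]_w shot (decay_lt t) w = (expected_intensity t)%:E)%E.
Proof.
by move=> t0; rewrite integral_shot_lt// -(fineK (epoch_series_r_fin t0)) -EFinM -EFinD.
Qed.

Lemma rate_le N t : 0 <= t -> rate N t <= expected_intensity t.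
Proof.
move=> t0; rewrite -lee_fin -integral_shotE// fineK; last first.
  exact/integral_shot_lt_fin/measurable_epoch_gt.
by apply: ge0_subset_integral => //; exact: measurable_epoch_gt.
Qed.

(** Epochs tend to infinity on every path, so the events [t < tau N] exhaust the space and monotone
    convergence applies. *)
Lemma rate_cvg t : 0 <= t -> rate N t @[N --> \oo] --> expected_intensity t.
Proof.
move=> t0; pose F N := [set w | t < tau N w].
have FE : \bigcup_N F N = setT.
  apply/seteqP; split => // w _.
  have /cvgryPgt/(_ t)[N _ HN] := tau_oo w.
  by exists N => //; exact: HN (leqnn N).
have : (\int[P]_(w in F N) shot (decay_lt t) w @[N --> \oo] --> (expected_intensity t)%:E)%E.
  rewrite -integral_shotE// -FE; apply: ge0_nondecreasing_set_cvg_integral => //.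
    move=> n m nm; apply/subsetPset => w /=; rewrite /F/= => /lt_le_trans; apply.
    by apply: (epoch_le (x := tau ^~ w)).
  by move=> N; exact: measurable_epoch_gt.
by move=> /fine_cvgP[].
Qed.

(** On [[x, y[] the rate is at most [expected_intensity], whose exponential is largest at [x] and
    whose [mean_sum r] is largest at [y]. The bound is free of [N], so it survives the limit; it
    yields continuity and the upper half of the derivative. *)
Lemma mean_sum_incr a x y : 0 <= a -> 0 <= x -> x <= y ->
  mean_sum a y - mean_sum a x <=
  expR (a * y) * (lam + b1 * expR (- r * x) * mean_sum r y) * (y - x).
Proof.
move=> a0 x0 xy; have y0 := le_trans x0 xy.
set K := _ * (lam + _).
rewrite lerBlDr; apply: (cvgr_to_le (partial_mean_cvg a0 y0)).
near=> N.
rewrite -lerBlDr (@le_trans _ _ (partial_mean a N y - partial_mean a N x))//.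
  by rewrite lerD2l lerN2 partial_mean_le.
(* An upper bound on growth is [rderiv_ge] for the negated function, whose left condition now rests
   on the absence of atoms. *)
have : - K * (y - x) <= - partial_mean a N y - - partial_mean a N x.
  apply: (@rderiv_ge _ (fun t => - partial_mean a N t)
    (fun t => - (expR (a * t) * rate N t))) => //.
    move=> c /andP[xc cy] e e0.
    have := @partial_mean_left_cvg a N c a0 (ltW (le_lt_trans x0 xc)).
    move=> /cvgrPdist_le/(_ _ e0); apply: filterS => z.
    by rewrite ler_norml => /andP[_]; lra.
  move=> z /andP[xz zy]; have z0 := le_trans x0 xz; split.
    exact/rderivN/partial_mean_rderiv.
  rewrite lerN2 /K; apply: ler_pM; [exact: expR_ge0|exact: rate_ge0| |].
    by rewrite ler_expR ler_wpM2l// ltW.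
  apply: le_trans (rate_le N z0) _; rewrite lerD2l.
  apply: ler_pM; [|exact: mean_sum_ge0| |].
  - by rewrite mulr_ge0 ?expR_ge0 ?(ltW mark_mean_gt0).
  - by rewrite ler_pM2l ?mark_mean_gt0// ler_expR !mulNr lerN2 ler_pM2l.
  - by apply: mean_sum_nd; rewrite ?(ltW r_gt0)// ltW.
lra.
Unshelve. all: by end_near. Qed.

Lemma mean_sum_right_cvg a t : 0 <= a -> 0 <= t ->
  mean_sum a (t + h) @[h --> 0^'+] --> mean_sum a t.
Proof.
move=> a0 t0.
(* A slope for [mean_sum_incr] valid for all [h <= 1]. *)
pose K := expR (a * (t + 1)) * (lam + b1 * expR (- r * t) * mean_sum r (t + 1)).
have K0 : 0 <= K.
  rewrite mulr_ge0 ?expR_ge0// addr_ge0 ?(ltW lam_gt0)//.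
  by rewrite !mulr_ge0 ?expR_ge0 ?mean_sum_ge0 ?(ltW mark_mean_gt0).
apply: (@squeeze_cvgr _ _ _ _ (fun=> mean_sum a t) (fun h => mean_sum a t + K * h)).
- near=> h; have h0 : 0 < h by [].
  have h1 : h <= 1 by near: h; apply: nbhs_right_le.
  apply/andP; split; first by apply: mean_sum_nd => //; rewrite lerDl ltW.
  have th : t <= t + h by rewrite lerDl ltW.
  rewrite -lerBlDl; apply: le_trans (mean_sum_incr a0 t0 th) _.
  rewrite [t + h - t]addrAC subrr add0r ler_pM2r// /K.
  apply: ler_pM => //.
  + rewrite addr_ge0 ?(ltW lam_gt0)//.
    by rewrite !mulr_ge0 ?expR_ge0 ?mean_sum_ge0 ?(ltW mark_mean_gt0).
  + by rewrite ler_expR ler_wpM2l// lerD2l.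
  + rewrite lerD2l ler_wpM2l//; first by rewrite mulr_ge0 ?expR_ge0 ?(ltW mark_mean_gt0).
    by apply: mean_sum_nd; rewrite ?(ltW r_gt0) ?(le_trans t0)// lerD2l.
- exact: cvg_cst.
- rewrite -[X in _ --> X]addr0 -[X in _ + X](mulr0 K).
  apply: cvgD; first exact: cvg_cst.
  apply: cvgM; first exact: cvg_cst.
  by apply: cvg_at_right_filter; exact: cvg_id.
Unshelve. all: by end_near. Qed.

Lemma mean_sum_left_cvg a c : 0 <= a -> 0 < c ->
  mean_sum a x @[x --> c^'-] --> mean_sum a c.
Proof.
move=> a0 c0.
(* Bounding [exp(- r x)] by 1 makes this slope independent of [x]. *)
pose K := expR (a * c) * (lam + b1 * mean_sum r c).
have K0 : 0 <= K.
  rewrite mulr_ge0 ?expR_ge0// addr_ge0 ?(ltW lam_gt0)//.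
  by rewrite !mulr_ge0 ?mean_sum_ge0 ?(ltW mark_mean_gt0).
apply: (@squeeze_cvgr _ _ _ _ (fun x => mean_sum a c - K * (c - x)) (fun=> mean_sum a c)).
- near=> x; have xc : x < c by [].
  have x0 : 0 <= x by near: x; exact: nbhs_left_ge.
  apply/andP; split; last by apply: mean_sum_nd => //; exact: ltW.
  rewrite lerBlDr -lerBlDl; apply: le_trans (mean_sum_incr a0 x0 (ltW xc)) _.
  rewrite ler_pM2r ?subr_gt0// /K ler_pM2l ?expR_gt0// lerD2l.
  rewrite ler_wpM2r ?mean_sum_ge0// -[leRHS]mulr1 ler_pM2l ?mark_mean_gt0//.
  by rewrite -expR0 ler_expR mulNr oppr_le0 mulr_ge0 ?(ltW r_gt0).
- rewrite -[X in _ --> X]subr0 -[X in _ - X](mulr0 K) -[X in _ * X](subrr c).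
  apply: cvgB; first exact: cvg_cst.
  apply: cvgM; first exact: cvg_cst.
  apply: cvgB; first exact: cvg_cst.
  by apply: cvg_at_left_filter; exact: cvg_id.
- exact: cvg_cst.
Unshelve. all: by end_near. Qed.

(** The limit in [N] and the right derivative are exchanged by two bounds. From above, the quotient
    is at most [U h], which converges by right continuity. From below, [mean_sum] grows at least as
    fast as any [partial_mean], whose derivative is near the target for large [N] by [rate_cvg]. *)
Lemma mean_sum_rderiv a t : 0 <= a -> 0 <= t ->
  rderiv (mean_sum a) t (expR (a * t) * expected_intensity t).
Proof.
move=> a0 t0.
pose U h := expR (a * (t + h)) * (lam + b1 * expR (- r * t) * mean_sum r (t + h)).
have cU : U h @[h --> 0^'+] --> expR (a * t) * expected_intensity t.
  apply: cvgM; first exact: (rderiv_right_cvg (u := fun x => expR (a * x)) (@rderiv_expR R a t)).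
  apply: cvgD; first exact: cvg_cst.
  by apply: cvgM; [exact: cvg_cst|apply: mean_sum_right_cvg => //; exact: ltW].
apply/cvgrPdist_le => e e0.
have e2 : 0 < e / 2 by rewrite divr_gt0.
have cR : expR (a * t) * rate N t @[N --> \oo] --> expR (a * t) * expected_intensity t.
  by apply: cvgM; [exact: cvg_cst|exact: rate_cvg].
move/cvgrPdist_le : cR => /(_ _ e2)[N _ HN].
have := @partial_mean_rderiv a N t a0 t0.
move=> /cvgrPdist_le/(_ _ e2) HC.
near=> h; have h0 : 0 < h by [].
have th : t <= t + h by rewrite lerDl ltW.
rewrite ler_norml; apply/andP; split.
  have : `|expR (a * t) * expected_intensity t - U h| <= e.
    by near: h; move/cvgrPdist_le : cU; exact.
  rewrite ler_norml => /andP[HU _].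
  have : h^-1 * (mean_sum a (t + h) - mean_sum a t) <= U h.
    rewrite ler_pdivrMl// mulrC.
    have := mean_sum_incr a0 t0 th.
    by rewrite [X in _ * X]addrAC subrr add0r.
  lra.
have : `|expR (a * t) * rate N t - h^-1 * (partial_mean a N (t + h) - partial_mean a N t)| <= e / 2.
  by near: h.
rewrite ler_norml => /andP[_ H1].
have := HN N (leqnn N); rewrite /= ler_norml => /andP[_ H2].
have : h^-1 * (partial_mean a N (t + h) - partial_mean a N t) <=
    h^-1 * (mean_sum a (t + h) - mean_sum a t).
  rewrite ler_pM2l ?invr_gt0//.
  have th0 := le_trans t0 th.
  rewrite lerBrDr addrAC lerBlDr.
  (* The terms beyond [N] are nondecreasing in time, so a longer sum grows at least as much; then
     [M] goes to infinity. *)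
  have tail (M : nat) : (N <= M)%N ->
     partial_mean a N (t + h) + partial_mean a M t <= partial_mean a M (t + h) + partial_mean a N t.
    move=> NM; rewrite /partial_mean -!(big_mkord xpredT (epoch_mean a _)).
    rewrite (big_cat_nat (leq0n N.+1) (NM : (N.+1 <= M.+1)%N))/=.
    rewrite [X in _ <= X + _](big_cat_nat (leq0n N.+1) (NM : (N.+1 <= M.+1)%N))/=.
    rewrite -addrA lerD2l addrC lerD2r.
    by apply: ler_sum => i _; exact: epoch_mean_nd.
  have c1 : partial_mean a N (t + h) + partial_mean a M t @[M --> \oo] -->
      partial_mean a N (t + h) + mean_sum a t.
    by apply: cvgD; [exact: cvg_cst|exact: partial_mean_cvg].
  have c2 : partial_mean a M (t + h) + partial_mean a N t @[M --> \oo] -->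
      mean_sum a (t + h) + partial_mean a N t.
    by apply: cvgD; [exact: partial_mean_cvg|exact: cvg_cst].
  apply: (ler_cvg_to c1 c2); near=> M; apply: tail; near: M; exact: nbhs_infty_ge.
lra.
Unshelve. all: by end_near. Qed.

Lemma mean_sum0 a : mean_sum a 0 = 0.
Proof.
rewrite /mean_sum /epoch_series eseries0// => n _ _.
rewrite /epoch_mean /Rintegral integral0_eq// => w _.
by rewrite /exp_le leNgt epoch_gt0n.
Qed.

(** ** Explicit means *)

Hypothesis r_neq_b1 : r != b1.

Let r0_neq0 : r - b1 != 0.
Proof. by rewrite subr_eq0. Qed.

(* [exp(-b1 t) Z(t)], with [Z = mean_sum r], has right derivative
   [lam exp((r - b1) t)]. *)
Lemma mean_sum_rE t : 0 <= t ->
  expR (- b1 * t) * mean_sum r t = lam / (r - b1) * (expR ((r - b1) * t) - 1).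
Proof.
move=> t0; have r0 := ltW r_gt0.
pose u x := expR (- b1 * x) * mean_sum r x + - (lam / (r - b1)) * expR ((r - b1) * x).
have : u t = u 0.
  apply: rderiv0_cst => // [c /andP[c0 _]|x /andP[x0 _]].
    apply: cvgD; apply: cvgM.
    - exact: expR_left_cvg.
    - exact: mean_sum_left_cvg.
    - exact: cvg_cst.
    - exact: expR_left_cvg.
  have := rderivD (rderivM (@rderiv_expR R (- b1) x) (mean_sum_rderiv r0 x0))
    (rderivM (@rderiv_cst R (- (lam / (r - b1))) x) (@rderiv_expR R (r - b1) x)).
  rewrite [X in rderiv _ _ X](_ : _ = 0)// mul0r add0r /expected_intensity.
  have e1 : expR (r * x) * expR (- r * x) = 1 by rewrite -expRD mulNr subrr expR0.
  have -> : expR ((r - b1) * x) = expR (- b1 * x) * expR (r * x).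
    by rewrite -expRD; congr expR; ring.
  have -> : expR (r * x) * (lam + b1 * expR (- r * x) * mean_sum r x) =
      lam * expR (r * x) + b1 * (expR (r * x) * expR (- r * x)) * mean_sum r x by ring.
  by rewrite e1; field.
rewrite /u !mulr0 expR0 mean_sum0 mulr0 add0r mulr1 => H.
lra.
Qed.

Lemma expected_intensityE t : 0 <= t -> expected_intensity t = mean_intensity lam r b1 t.
Proof.
move=> t0; rewrite /expected_intensity /mean_intensity.
have -> : b1 * expR (- r * t) * mean_sum r t =
    b1 * expR (- (r - b1) * t) * (expR (- b1 * t) * mean_sum r t).
  have -> : expR (- r * t) = expR (- (r - b1) * t) * expR (- b1 * t).
    by rewrite -expRD; congr expR; ring.
  by ring.
rewrite mean_sum_rE//.
have e1 : expR (- (r - b1) * t) * expR ((r - b1) * t) = 1.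
  by rewrite -expRD mulNr addNr expR0.
have -> : b1 * expR (- (r - b1) * t) * (lam / (r - b1) * (expR ((r - b1) * t) - 1)) =
   b1 * lam / (r - b1) * (expR (- (r - b1) * t) * expR ((r - b1) * t) - expR (- (r - b1) * t)).
  by ring.
by rewrite e1; field.
Qed.

Lemma expectation_intensity t : 0 <= t ->
  'E_P[intensity lam r tau B t]%E = (mean_intensity lam r b1 t)%:E.
Proof.
move=> t0; rewrite unlock integral_intensity_shot//.
by rewrite integral_shotE// expected_intensityE.
Qed.

(** [rderiv0_cst] on the difference. An explicit antiderivative can then be guessed and checked,
    separately for [a] different from and equal to [r - b1]. *)
Lemma mean_sum_unique a (F : R -> R) t : 0 <= a -> 0 <= t -> F 0 = 0 ->
  (forall c, F x @[x --> c^'-] --> F c) ->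
  (forall x, rderiv F x (expR (a * x) * mean_intensity lam r b1 x)) ->
  mean_sum a t = F t.
Proof.
move=> a0 t0 F0 Fl Fr.
suff : mean_sum a t + - F t = mean_sum a 0 + - F 0.
  by rewrite mean_sum0 F0 subr0 => /eqP; rewrite subr_eq0 => /eqP.
apply: (@rderiv0_cst _ (fun x => mean_sum a x + - F x)) => // [c /andP[c0 _]|x /andP[x0 _]].
  by apply: cvgD; [exact: mean_sum_left_cvg|exact: cvgN].
rewrite -(subrr (expR (a * x) * mean_intensity lam r b1 x)).
apply: rderivD; last exact/rderivN.
by rewrite -expected_intensityE//; exact: mean_sum_rderiv.
Qed.

Lemma mean_sumE a t : 0 < a -> a != r - b1 -> 0 <= t ->
  mean_sum a t = lam * r / (r - b1) / a * (expR (a * t) - 1) -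
    lam * b1 / (r - b1) / (a - (r - b1)) * (expR ((a - (r - b1)) * t) - 1).
Proof.
move=> a0 ar0 t0.
have ar0' : a - (r - b1) != 0 by rewrite subr_eq0.
pose F x := lam * r / (r - b1) / a * (expR (a * x) + - 1) +
    - (lam * b1 / (r - b1) / (a - (r - b1))) * (expR ((a - (r - b1)) * x) + - 1).
rewrite (@mean_sum_unique a F)//.
- by rewrite /F mulNr.
- exact: ltW.
- by rewrite /F !mulr0 expR0 subrr !mulr0 addr0.
- move=> c; apply: cvgD; (apply: cvgM; first exact: cvg_cst);
    by apply: cvgD; [exact: expR_left_cvg|exact: cvg_cst].
- move=> x.
  have := rderivD
    (@rderivZ R (lam * r / (r - b1) / a) _ _ _
      (rderivD (@rderiv_expR R a x) (@rderiv_cst R (- 1) x)))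
    (@rderivZ R (- (lam * b1 / (r - b1) / (a - (r - b1))))
      _ _ _ (rderivD (@rderiv_expR R (a - (r - b1)) x) (@rderiv_cst R (- 1) x))).
  rewrite [X in rderiv _ _ X -> _](_ : _ = expR (a * x) * mean_intensity lam r b1 x)//.
  rewrite /mean_intensity.
  have -> : expR ((a - (r - b1)) * x) = expR (a * x) * expR (- (r - b1) * x).
    by rewrite -expRD; congr expR; ring.
  by field; rewrite (gt_eqF a0) ar0' r0_neq0.
Qed.

(** The resonant case: the weight cancels the decaying exponential of the mean intensity, and the
    constant left over integrates to a term linear in [t]. *)
Lemma mean_sumE_eq t : 0 < r - b1 -> 0 <= t ->
  mean_sum (r - b1) t = lam * r / (r - b1) / (r - b1) * (expR ((r - b1) * t) - 1) -
    lam * b1 / (r - b1) * t.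
Proof.
move=> a0 t0.
pose F x := lam * r / (r - b1) / (r - b1) * (expR ((r - b1) * x) + - 1) +
    - (lam * b1 / (r - b1)) * x.
rewrite (@mean_sum_unique (r - b1) F)//.
- by rewrite /F mulNr.
- exact: ltW.
- by rewrite /F !mulr0 expR0 subrr !mulr0 addr0.
- move=> c; apply: cvgD; (apply: cvgM; first exact: cvg_cst).
    by apply: cvgD; [exact: expR_left_cvg|exact: cvg_cst].
  by apply: cvg_at_left_filter; exact: cvg_id.
- move=> x.
  have := rderivD
    (@rderivZ R (lam * r / (r - b1) / (r - b1)) _ _ _
      (rderivD (@rderiv_expR R (r - b1) x) (@rderiv_cst R (- 1) x)))
    (@rderivZ R (- (lam * b1 / (r - b1))) _ _ _ (@rderiv_id R x)).
  rewrite [X in rderiv _ _ X -> _](_ : _ = expR ((r - b1) * x) * mean_intensity lam r b1 x)//.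
  rewrite /mean_intensity.
  have e1 : expR ((r - b1) * x) * expR (- (r - b1) * x) = 1.
    by rewrite -expRD mulNr subrr expR0.
  rewrite mulrBr [X in _ = _ - X]mulrCA e1.
  by field.
Qed.

(** * The number of customers *)

Section Queue.
Variables (mu : R) (S : nat -> {RV P >-> R}).
Hypothesis mu_gt0 : 0 < mu.
Hypothesis service : is_service mu tau B S.

Let present t (z : R * R) : \bar R := ((z.1 <= t < z.1 + z.2)%R%:R)%:E.

Let measurable_present t : measurable_fun setT (present t).
Proof.
apply/measurable_EFinP.
rewrite (_ : (fun _ => _) = (fun z : R * R =>
    if (z.1 <= t) && (t < z.1 + z.2) then 1 else 0)); last first.
  by apply/funext => z; case: (_ && _).
apply: measurable_fun_ifT => //.
apply: measurable_and; first exact: measurable_fun_ler.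
apply: measurable_fun_ltr => //.
exact: measurable_funD.
Qed.

(** Given an epoch [u <= t], the customer is still there when the service exceeds [t - u], which has
    probability [exp(- mu t) exp(mu u)]. *)
Lemma integral_present t n :
  (\int[P]_w ((tau n w <= t < tau n w + S n w)%R%:R)%:E =
   (expR (- mu * t) * epoch_mean mu t n)%:E)%E.
Proof.
have mu0 := ltW mu_gt0.
have indep U V : measurable U -> measurable V ->
    P (tau n @^-1` U `&` S n @^-1` V) = (P (tau n @^-1` U) * P (S n @^-1` V))%E.
  move=> mU mV; apply: (service_independent_arrivals service).
    by apply: sigma_joinl; apply: (sigma_family_preimage (X := tau)).
  exact: (sigma_family_preimage (X := S)).
rewrite -[LHS]/(\int[P]_w present t (tau n w, S n w))%E.
rewrite (@independent_integral _ _ _ P _ _ _ _ (tau n) (S n) (present t))//; last first.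
  by move=> z; rewrite lee_fin.
transitivity (\int[distribution P (tau n)]_x (expR (- mu * t) * exp_le mu t x)%:E)%E.
  apply: eq_integral => u _; rewrite /exp_le; case: ifPn => [ut|tu]; last first.
    by rewrite mulr0 integral0_eq// => s _; rewrite /present/= (negbTE tu).
  rewrite -expRD (_ : _ + _ = - mu * (t - u)); last by ring.
  rewrite -(@exponential_ccdf _ _ _ P mu (S n)); last 2 first.
  - exact: (service_distribution service).
  - by rewrite subr_ge0.
  transitivity (\int[distribution P (S n)]_s
      (\1_(`]t - u, +oo[%classic : set R) s)%:E)%E; last first.
    by rewrite integral_indic// setIT.
  apply: eq_integral => s _; rewrite /present/= ut/= indicE; congr (_%:R%:E); congr nat_of_bool.
  by apply/idP/idP; rewrite inE/= in_itv/= andbT ltrBlDl.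
rewrite ge0_integral_distribution//=; last 2 first.
- by apply/measurable_EFinP/measurable_funM => //; exact: measurable_exp_le.
- by move=> u; rewrite lee_fin mulr_ge0 ?expR_ge0 ?exp_le_ge0.
have : (\int[P]_w ((expR (- mu * t))%:E * (exp_le mu t (tau n w))%:E) =
    (expR (- mu * t))%:E * \int[P]_w (exp_le mu t (tau n w))%:E)%E.
  rewrite ge0_integralZl//.
  - by apply: (measurable_int P); exact: integrable_exp_le.
  - by move=> w _; rewrite lee_fin exp_le_ge0.
by rewrite epoch_meanE// EFinM => <-.
Qed.

Lemma expectation_in_system t : 0 <= t ->
  'E_P[fun w => (in_system tau S t w)%:R%R]%E = (expR (- mu * t) * mean_sum mu t)%:E.
Proof.
move=> t0; rewrite unlock.
transitivity (\int[P]_w \sum_(n <oo) ((tau n w <= t < tau n w + S n w)%R%:R)%:E)%E.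
  apply: eq_integral => w _.
  exact: (in_system_sum (tau := tau) (tau_incr w) (tau_oo w) S t).
rewrite integral_nneseries//; last first.
  move=> n; have : measurable_fun setT (present t \o (fun w => (tau n w, S n w))).
    by apply: measurableT_comp => //; exact: measurable_fun_pair.
  exact.
under eq_eseriesr do rewrite integral_present EFinM.
rewrite nneseriesZl; last by move=> n _; rewrite lee_fin epoch_mean_ge0.
by rewrite -/(epoch_series mu t) EFinM fineK// epoch_series_fin// ltW.
Qed.

(** Stated for a free [m] because the case of [mu] equal to [r - b1] needs it along [m] tending to
    that value. *)
Lemma mean_in_systemE m t : m != 0 -> m != r - b1 ->
  mean_in_system lam r b1 m t =
  expR (- m * t) * (lam * r / (r - b1) / m * (expR (m * t) - 1) -
    lam * b1 / (r - b1) / (m - (r - b1)) * (expR ((m - (r - b1)) * t) - 1)).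
Proof.
move=> m0 mr0.
have mr0' : m - (r - b1) != 0 by rewrite subr_eq0.
have e1 : expR (- m * t) * expR (m * t) = 1.
  by rewrite -expRD mulNr addNr expR0.
have e2 : expR (- m * t) * expR ((m - (r - b1)) * t) = expR (- (r - b1) * t).
  by rewrite -expRD; congr expR; ring.
have -> : forall c1 c2, expR (- m * t) * (c1 * (expR (m * t) - 1) -
    c2 * (expR ((m - (r - b1)) * t) - 1)) = c1 * (expR (- m * t) * expR (m * t) - expR (- m * t))
    - c2 * (expR (- m * t) * expR ((m - (r - b1)) * t) - expR (- m * t)).
  by move=> c1 c2; ring.
rewrite e1 e2 /mean_in_system.
by field; rewrite m0 mr0' r0_neq0.
Qed.

(** The difference quotient of [exp(t x)] at [x = 0], recentred at [c]; it resolves the singularity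
    of the closed formula at [m = r - b1]. *)
Lemma expR_slope_cvg (c t : R) :
  (m - c)^-1 * (expR ((m - c) * t) - 1) @[m --> c^'] --> t.
Proof.
have := is_derive_expRM t 0; rewrite mulr0 expR0 mulr1 => -[+ dt].
move=> /cvg_ex[l Hl].
have lt : l = t by rewrite -dt; apply/esym/cvg_lim.
move: Hl; rewrite lt => /cvgrPdist_le Hl.
apply/cvgrPdist_le => e e0; have [d' /= d'0 Hd] := Hl e e0.
exists d' => // m /= mc mneq.
have := Hd (m - c); rewrite /= sub0r normrN distrC => /(_ mc).
rewrite subr_eq0 => /(_ mneq).
by rewrite /= addr0 mulr0 expR0 [(m - c) *: 1]mulr1 [t * _]mulrC.
Qed.

Lemma mean_in_system_cvg t : 0 < r - b1 -> 0 <= t ->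
  mean_in_system lam r b1 m t @[m --> (r - b1)^'] -->
  expR (- (r - b1) * t) * mean_sum (r - b1) t.
Proof.
move=> r0_gt0 t0; rewrite mean_sumE_eq//.
have cid : m @[m --> (r - b1)^'] --> r - b1 by exact: cvg_within.
have cexp (a : R) : expR (a * m * t) @[m --> (r - b1)^'] --> expR (a * (r - b1) * t).
  apply: continuous_cvg; first exact: continuous_expR.
  by apply: cvgM; [apply: cvgM => //; exact: cvg_cst|exact: cvg_cst].
(* Signs are written as factors [-1] and [1] so that [cexp] covers both exponentials. *)
have : expR (-1 * m * t) * (lam * r / (r - b1) / m * (expR (1 * m * t) - 1) -
    lam * b1 / (r - b1) * ((m - (r - b1))^-1 * (expR ((m - (r - b1)) * t) - 1)))
    @[m --> (r - b1)^'] -->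
  expR (-1 * (r - b1) * t) * (lam * r / (r - b1) / (r - b1) * (expR (1 * (r - b1) * t) - 1) -
    lam * b1 / (r - b1) * t).
  apply: cvgM; first exact: cexp.
  apply: cvgB; last by apply: cvgM; [exact: cvg_cst|exact: expR_slope_cvg].
  apply: cvgM; first by apply: cvgM; [exact: cvg_cst|apply: cvgV].
  by apply: cvgB; [exact: cexp|exact: cvg_cst].
rewrite mulN1r mul1r; apply: cvg_trans; apply: near_eq_cvg.
near=> m.
rewrite mean_in_systemE ?mulN1r ?mul1r ?mulrA//.
- near: m; apply: cvgr_neq0 cid _; exact: lt0r_neq0.
- by near: m; exact: nbhs_dnbhs_neq.
Unshelve. all: by end_near. Qed.

End Queue.

End Hawkes.

Theorem corollary3p4 (R : realType)
    (d : measure_display) (T : measurableType d) (P : probability T R)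
    (d0 : measure_display) (T0 : measurableType d0) (P0 : probability T0 R)
    (B0 : {RV P0 >-> R}) (lam r mu b1 : R)
    (tau B S : nat -> {RV P >-> R})
    (lam_gt0 : 0 < lam) (r_gt0 : 0 < r) (mu_gt0 : 0 < mu)
    (B0_gt0 : P0 [set w | 0 < B0 w] = 1%E)
    (B0_mean : 'E_P0[B0]%E = b1%:E)
    (hawkes : is_hawkes B0 lam r tau B)
    (service : is_service mu tau B S)
    (r_neq_b1 : r != b1)
    (t : R) (t_ge0 : 0 <= t) :
  let r0 := r - b1 in
  'E_P[intensity lam r tau B t]%E = (mean_intensity lam r b1 t)%:E /\
  (mu != r0 ->
    'E_P[fun w => (in_system tau S t w)%:R%R]%E = (mean_in_system lam r b1 mu t)%:E) /\
  (mu = r0 ->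
    (mean_in_system lam r b1 m t)%:E @[m --> r0^'] -->
      'E_P[fun w => (in_system tau S t w)%:R%R]%E).
Proof.
move=> r0.
have EN : 'E_P[fun w => (in_system tau S t w)%:R%R]%E = (expR (- mu * t) * mean_sum tau mu t)%:E.
  exact: (expectation_in_system lam_gt0 r_gt0 B0_gt0 B0_mean hawkes mu_gt0 service).
split; first exact: (expectation_intensity lam_gt0 r_gt0 B0_gt0 B0_mean hawkes).
split=> [mur0|mur0].
  rewrite EN mean_in_systemE ?(lt0r_neq0 mu_gt0)//.
  by rewrite (mean_sumE lam_gt0 r_gt0 B0_gt0 B0_mean hawkes).
rewrite EN mur0; apply: cvg_EFin; first exact: nearW.
apply: (mean_in_system_cvg lam_gt0 r_gt0 B0_gt0 B0_mean hawkes) => //.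
by rewrite -/r0 -mur0.
Qed.
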